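(* Let $K\subset\mathbb{R}^2$ be a centrally symmetric convex body, and for $t\in\mathbb{R}$ let $I_K(t)=|E_t\cap K|$, where $E_t=\{(x,y)\in\mathbb{R}^2 : e^{t}x^2+e^{-t}y^2\le 1\}$. Let $J\subseteq\mathbb{R}$ be an interval such that $I_K(t)<\min\{\pi,|K|\}$ for every $t\in J$. Then the restriction of $I_K$ to $J$ is a strictly quasiconcave function.
   Context: A convex body in $\mathbb{R}^2$ is a compact convex set with nonempty interior; $K$ is centrally symmetric if $K=-K$. $|\cdot|$ denotes area. A real function $f$ on an interval $J$ is strictly quasiconcave if for all $t_0<t_1<t_2$ in $J$ one has $f(t_1)>\min\{f(t_0),f(t_2)\}$. *)

(* Defs.v *)
From HB Require Import structures.
From mathcomp Require Import all_boot all_order all_algebra.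
From mathcomp Require Import all_classical all_reals all_analysis.

Set Implicit Arguments.
Unset Strict Implicit.
Unset Printing Implicit Defensive.

Import Order.TTheory GRing.Theory Num.Theory.
Import numFieldNormedType.Exports.

Local Open Scope classical_set_scope.
Local Open Scope ring_scope.

Definition convex_body (R : realType) (K : set (R * R)) : Prop :=
  [/\ compact K, convex_set K & K° !=set0].

Definition centrally_symmetric (R : realType) (K : set (R * R)) : Prop :=
  K = [set - p | p in K].

(* [fine] sends +oo to 0; it loses nothing on bounded Borel sets, which is
   how [area] is used. *)
Definition area (R : realType) (A : set (R * R)) : R :=
  fine ((@lebesgue_measure R \x @lebesgue_measure R)%E A).

Definition ellipse (R : realType) (t : R) : set (R * R) :=
  [set p | expR t * p.1 ^+ 2 + expR (- t) * p.2 ^+ 2 <= 1].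

Definition intersection_area (R : realType) (K : set (R * R)) (t : R) : R :=
  area (ellipse t `&` K).

Definition strictly_quasiconcave_on (R : realType) (J : set R) (f : R -> R)
    : Prop :=
  forall t0 t1 t2 : R, J t0 -> J t1 -> J t2 -> t0 < t1 -> t1 < t2 ->
    Num.min (f t0) (f t2) < f t1.

(* Main.v *)
(* In slope coordinates (x, x m) the area of a symmetric star-shaped set {x^2 <= w(m)} is the
   integral of w over the line. Hence I_K(t) is the integral of min(rho_t, w), where rho_t is the
   explicit function of E_t and w that of K. I_K is continuous, so if it is not strictly
   quasiconcave on J, it has a local minimum in J; a unimodular linear map turns the ellipse there
   into the unit disk. Let S be the set of slopes at which the unit circle lies in K. Vanishing of
   the first variation is a moment condition on S. In the second variation S contributes an
   explicit integral, while at each end e of a gap of S the chord spanning the gap, which lies in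
   K by convexity, forces a loss cot(h) xi(e)^2, with h half the angle of the gap. A trigonometric
   inequality bounds the loss of each gap below by the integral over the gap of one density psi,
   whose integral over S is known from the moment condition; summing over the gaps contradicts
   minimality. The axes are rotated so that one gap is symmetric about the vertical, of angle at
   least a right angle if there is such a gap: then either that gap covers all slopes |m| > 1 or
   all other gaps are acute, and the bound holds with a suitable, respectively zero, multiplier. *)
Require Import Defs.
From HB Require Import structures.
From mathcomp Require Import all_boot all_order all_algebra.
From mathcomp Require Import all_classical all_reals all_analysis.
From mathcomp Require Import measurable_realfun.
From mathcomp Require Import ring lra.
Import Order.TTheory GRing.Theory Num.Theory.
Import numFieldNormedType.Exports.
Local Open Scope classical_set_scope.
Local Open Scope ring_scope.
Set Implicit Arguments.
Unset Strict Implicit.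
Unset Printing Implicit Defensive.

(** * Area in slope coordinates *)

Section Affine.
Context {R : realType}.
Notation mu := (@lebesgue_measure R).

(** Refuting a local minimum takes only upper bounds on nearby values of [I_K]. Hence any piece off
    the contact set may be dropped, and on a gap it is enough that [w] lies between the chord and
    the circle. The estimate of a gap contains a square, which is not additive over gaps; bounding
    it below by a tangent line turns it into the integral of a density. The sign of that square is
    the sign of the cosine of the gap angle. For an obtuse gap it is unfavourable, and the
    multiplier, acting on all other gaps, recovers exactly what is lost. The balance is tight for a
    right-angled gap whose bisector is an axis of the ellipses; strictness then comes from the
    positive measure of the contact set, that is from [I_K < |K|]. Thresholds on the deformation
    parameter depend on the gap, so finitely many gaps are summed first, and the limit is taken in
    an inequality free of that parameter. Slope coordinates make ellipses and chords rational; the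
    vertical direction they miss is placed inside a gap, which also makes the contact set
    compact. *)

Lemma measurable_affine (a b : R) :
  measurable_fun [set: R] (fun y => a * y + b).
Proof.
apply: measurable_funD; last exact: measurable_cst.
by apply: measurable_funM; [exact: measurable_cst|exact: measurable_id].
Qed.

Definition affine (a b : R) : measurableTypeR R -> measurableTypeR R :=
  fun y => a * y + b.

HB.instance Definition _ (a b : R) :=
  isMeasurableFun.Build _ _ _ _ (affine a b) (measurable_affine a b).

Lemma lebesgue_measure_affine_pos (a b : R) (A : set R) : 0 < a -> measurable A ->
  (mu A = a%:E * mu (affine a b @^-1` A))%E.
Proof.
move=> a0 mA.
pose r : {nonneg R} := NngNum (ltW a0).
rewrite (@lebesgue_measure_unique R (mscale r (pushforward mu (affine a b)))) //.
move=> _ [[c d]] _ <- /=.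
rewrite /mscale /=.
have E : affine a b @^-1` `]c, d] = `]((c - b) / a), ((d - b) / a)]%classic.
  apply/seteqP; split => y /=; rewrite /affine !in_itv /=;
    rewrite ltr_pdivrMr // ler_pdivlMr // ltrBlDr lerBrDr ![y * a]mulrC;
    by move=> /andP[-> ->].
rewrite [X in (_ * X)%E](_ : _ = mu (`]((c - b) / a), ((d - b) / a)]%classic)).
  2: by rewrite -E.
rewrite !lebesgue_measure_itv /= !lte_fin.
rewrite ltr_pM2r ?invr_gt0 // ltrD2r.
case: ifPn => cd; last by rewrite mule0.
rewrite -!EFinD -EFinM; congr EFin; field; exact: lt0r_neq0.
Qed.

Lemma lebesgue_measure_affine (a b : R) (A : set R) : a != 0 -> measurable A ->
  (mu A = `|a|%:E * mu (affine a b @^-1` A))%E.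
Proof.
move=> a0 mA; have [ap|an|a00] := ltgtP 0 a.
- by rewrite gtr0_norm // -lebesgue_measure_affine_pos.
- rewrite ltr0_norm //.
  have mB : measurable [set y : R | A (- y)].
    by rewrite -[X in measurable X]setTI; exact: (measurable_funN (@measurable_id _ R setT)).
  rewrite -(lebesgue_measureN mA) /pushforward /preimage /=.
  rewrite (@lebesgue_measure_affine_pos (- a) (- b)) ?oppr_gt0 //.
  congr (_ * mu _)%E; by apply/seteqP; split => y; rewrite /preimage /affine /= mulNr -opprD opprK.
- by rewrite -a00 eqxx in a0.
Qed.

End Affine.

Section Area.
Context {R : realType}.
Notation mu := (@lebesgue_measure R).
Notation mu2 := (mu \x mu)%E.

Lemma measurable_mulr_fst_snd : measurable_fun [set: R * R] (fun p : R * R => p.1 * p.2).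
Proof. by apply: measurable_funM; [exact: measurable_fst|exact: measurable_snd]. Qed.

Lemma measurable_slope :
  measurable_fun [set: R * R] (fun p : R * R => (p.1, p.1 * p.2)).
Proof.
apply: measurable_fun_pair; [exact: measurable_fst|exact: measurable_mulr_fst_snd].
Qed.

Lemma measurable_slope_integrand (A : set (R * R)) : measurable A ->
  measurable_fun setT (fun p : R * R => (`|p.1| * \1_A (p.1, p.1 * p.2))%:E).
Proof.
move=> mA; apply/measurable_EFinP; apply: measurable_funM.
  by apply: measurableT_comp => //; exact: measurable_fst.
apply: (measurableT_comp (measurable_indic mA)); exact: measurable_slope.
Qed.

(** For fixed [x != 0] the substitution [y = x * m] has Jacobian [|x|]. It degenerates only on the
    null line [x = 0], hence an almost everywhere equality before the integrals are swapped. *)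
Lemma area_tonelli (A : set (R * R)) : measurable A ->
  (mu2 A = \int[mu]_m \int[mu]_x (`|x| * \1_A (x, x * m))%:E)%E.
Proof.
move=> mA.
pose g (p : R * R) : \bar R := (`|p.1| * \1_A (p.1, p.1 * p.2))%:E.
have mg : measurable_fun setT g by exact: measurable_slope_integrand.
have g0 p : (0 <= g p)%E by rewrite lee_fin mulr_ge0 // indic_ge0.
transitivity (\int[mu]_x \int[mu]_m g (x, m))%E; last exact: fubini_tonelli.
rewrite /product_measure1.
apply: ae_eq_integral => //.
- by apply: measurable_fun_xsection.
- exact: (@measurable_fun_fubini_tonelli_F _ _ _ _ R mu g mg g0).
exists [set 0]; split; [exact: measurable_set1|exact: lebesgue_measure_set1|].
move=> x /= H; apply: contrapT => x0; apply: H => _.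
have {}x0 : x != 0 by apply/eqP.
rewrite (lebesgue_measure_affine 0 x0); last exact: measurable_xsection.
rewrite /g /=.
under eq_integral do rewrite EFinM.
rewrite ge0_integralZl //=.
- congr (_ * _)%E.
  pose B := affine x 0 @^-1` xsection A x.
  have mB : measurable B.
    by have := measurable_affine x 0 measurableT (measurable_xsection x mA); rewrite setTI.
  transitivity (mu (B `&` setT)); first by rewrite setIT.
  rewrite -integral_indic //.
  apply: eq_integral => m _; congr EFin; rewrite /B !indicE; congr (nat_of_bool _)%:R.
  apply: asbool_equiv_eq; rewrite /xsection /affine /preimage /= addr0 inE //.
- apply/measurable_EFinP.
  exact: (measurableT_comp (measurable_indic mA) (measurableT_comp measurable_slope (pair1_measurable x))).
Qed.

End Area.

Section Slope.
Context {R : realType}.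
Notation mu := (@lebesgue_measure R).
Notation mu2 := (mu \x mu)%E.

Lemma integral_is_derive (f F : R -> R) (a b : R) : a <= b ->
  (forall x : R, is_derive x (1 : R) F (f x)) -> continuous f ->
  (\int[mu]_(x in `[a, b]) (f x)%:E = (F b - F a)%:E)%E.
Proof.
rewrite le_eqVlt => /predU1P[->|ab] dF cf.
  by rewrite set_itv1 integral_set1 subrr.
have cF : continuous F.
  by move=> x; apply/differentiable_continuous/derivable1_diffP; apply: ex_derive.
rewrite (@continuous_FTC2 _ _ F) // ?EFinB //.
- exact: continuous_subspaceT.
- split.
  + by move=> x _; apply: ex_derive.
  + by apply: cvg_at_right_filter; exact: cF.
  + by apply: cvg_at_left_filter; exact: cF.
- by move=> x _; rewrite derive1E; exact: derive_val.
Qed.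

Lemma integral_norm_itv (k : R) : 0 <= k ->
  (\int[mu]_(x in `[(- k)%R, k]) `|x|%:E = (k ^+ 2)%:E)%E.
Proof.
move=> k0.
have mn D : measurable_fun D (fun x : R => `|x|%:E).
  by apply/measurable_EFinP/measurable_funTS; exact: normr_measurable.
rewrite (@itv_bndbnd_setU _ _ (BLeft (- k)) (BLeft 0) (BRight k)) ?bnd_simp ?oppr_le0 //.
rewrite ge0_integral_setU //=; [|exact: mn|].
2:{
  apply/disj_setPS => y [/=]; rewrite 2!in_itv/= => /andP[_ yx] /andP[].
  by rewrite leNgt yx. }
rewrite integral_itv_bndo_bndc //.
transitivity (\int[mu]_(x in `[(- k)%R, 0%R]) (- x)%:E + \int[mu]_(x in `[0%R, k]) x%:E)%E.
  congr (_ + _)%E; apply: eq_integral => x; rewrite inE /= in_itv /= => /andP[h1 h2].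
    by rewrite ler0_norm.
  by rewrite ger0_norm.
have d1 (x : R) : is_derive x (1 : R) (fun x : R => - (x ^+ 2) / 2) (- x).
  by apply: is_derive_eq; rewrite /GRing.scale /=; field.
have d2 (x : R) : is_derive x (1 : R) (fun x : R => x ^+ 2 / 2) x.
  by apply: is_derive_eq; rewrite /GRing.scale /=; field.
rewrite (integral_is_derive _ d1) ?oppr_le0 //; last first.
  by move=> x; apply: continuousN.
rewrite (integral_is_derive _ d2) //; last by move=> x.
by rewrite -EFinD; congr EFin; field.
Qed.

(** The integral of [|x|] over [|x| <= sqrt (w m)] is exactly [w m], which makes the squared
    abscissa the natural radial function. Measurability of [w] comes out of Tonelli's theorem. *)
Lemma area_slope (A : set (R * R)) (w : R -> R) : measurable A ->
  (forall m, 0 <= w m) -> (forall x m, A (x, x * m) <-> x ^+ 2 <= w m) ->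
  measurable_fun setT w /\ (mu2 A = \int[mu]_m (w m)%:E)%E.
Proof.
move=> mA w0 Aw.
have inner m : (\int[mu]_x (`|x| * \1_A (x, (x * m)%R))%:E = (w m)%:E)%E.
  transitivity (\int[mu]_(x in `[(- Num.sqrt (w m))%R, Num.sqrt (w m)]) `|x|%:E)%E.
    rewrite [RHS]integral_mkcond; apply: eq_integral => x _.
    rewrite patchE indicE.
    have -> : ((x, x * m) \in A) = (x \in `[(- Num.sqrt (w m))%R, Num.sqrt (w m)]%classic).
      apply: asbool_equiv_eq; rewrite Aw /= in_itv /= -ler_norml.
      by rewrite -[x ^+ 2 <= _]ler_sqrt // sqrtr_sqr.
    by case: ifPn => _ /=; rewrite ?mulr1 ?mulr0.
  by rewrite integral_norm_itv ?sqrtr_ge0 // sqr_sqrtr.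
split; last by rewrite area_tonelli //; apply: eq_integral => m _; exact: inner.
apply/measurable_EFinP.
rewrite (_ : EFin \o w = fubini_G mu (fun p : R * R => (`|p.1| * \1_A (p.1, p.1 * p.2))%:E)); last first.
  by apply: funext => m; rewrite /fubini_G /= inner.
apply: measurable_fun_fubini_tonelli_G; first exact: measurable_slope_integrand.
by move=> p; rewrite lee_fin mulr_ge0 // indic_ge0.
Qed.

End Slope.

(** * Invariance of area under unimodular linear maps *)

Section Linear.
Context {R : realType}.
Notation mu := (@lebesgue_measure R).
Notation mu2 := (mu \x mu)%E.

Definition lin (a b c d : R) (p : R * R) : R * R :=
  (a * p.1 + b * p.2, c * p.1 + d * p.2).

Lemma measurable_lin a b c d : measurable_fun [set: R * R] (lin a b c d).
Proof.
have H (u v : R) : measurable_fun [set: R * R] (fun p : R * R => u * p.1 + v * p.2).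
  by apply: measurable_funD; apply: measurable_funM.
by apply: measurable_fun_pair; exact: H.
Qed.

Lemma measurable_lin_preimage a b c d (A : set (R * R)) :
  measurable A -> measurable (lin a b c d @^-1` A).
Proof. by move=> mA; rewrite -[X in measurable X]setTI; exact: measurable_lin. Qed.

(** The product measure built from the other sections agrees on rectangles, and uniqueness
    identifies the two. *)
Lemma area_ysection (A : set (R * R)) : measurable A ->
  (mu2 A = \int[mu]_y mu (ysection A y))%E.
Proof.
move=> mA.
apply: (@product_measure_unique _ _ _ _ R mu mu (mu \x^ mu)%E) => //.
by move=> A1 A2 m1 m2; exact: product_measure2E.
Qed.

Lemma area_shear_y c (A : set (R * R)) : measurable A ->
  (mu2 (lin 1 0 c 1 @^-1` A) = mu2 A)%E.
Proof.
move=> mA; apply: eq_integral => x _ /=.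
rewrite [RHS](lebesgue_measure_affine (c * x) (oner_neq0 R)); last exact: measurable_xsection.
rewrite normr1 mul1e; congr (mu _).
by apply/seteqP; split => y; rewrite /affine /= /xsection /lin /= !inE /= !mul1r mul0r addr0 addrC.
Qed.

Lemma area_shear_x b (A : set (R * R)) : measurable A ->
  (mu2 (lin 1 b 0 1 @^-1` A) = mu2 A)%E.
Proof.
move=> mA; rewrite !area_ysection //; last exact: measurable_lin_preimage.
apply: eq_integral => x _ /=.
rewrite [RHS](lebesgue_measure_affine (b * x) (oner_neq0 R)); last exact: measurable_ysection.
rewrite normr1 mul1e; congr (mu _).
by apply/seteqP; split => y; rewrite /affine /= /ysection /lin /= !inE /= !mul1r mul0r add0r.
Qed.

Lemma lin_comp a b c d a' b' c' d' p :
  lin a b c d (lin a' b' c' d' p) =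
  lin (a * a' + b * c') (a * b' + b * d') (c * a' + d * c') (c * b' + d * d') p.
Proof. by rewrite /lin /=; congr (_, _); ring. Qed.

Lemma lin_preimage_comp a b c d a' b' c' d' (A : set (R * R)) :
  lin a' b' c' d' @^-1` (lin a b c d @^-1` A) =
  lin (a * a' + b * c') (a * b' + b * d') (c * a' + d * c') (c * b' + d * d') @^-1` A.
Proof. by apply/seteqP; split => p; rewrite /preimage /= lin_comp. Qed.

Lemma eq_lin (a b c d a' b' c' d' : R) : a = a' -> b = b' -> c = c' -> d = d' ->
  lin a b c d = lin a' b' c' d'.
Proof. by move=> -> -> -> ->. Qed.

(** With a nonzero lower left entry the matrix is a product of three shears, each of which
    translates sections. If that entry vanishes, one more shear replaces it by [a], nonzero since
    then [a * d = 1]. *)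
Lemma area_lin (a b c d : R) (A : set (R * R)) : a * d - b * c = 1 -> measurable A ->
  (mu2 (lin a b c d @^-1` A) = mu2 A)%E.
Proof.
have main (a' b' c' d' : R) (A' : set (R * R)) :
    c' != 0 -> a' * d' - b' * c' = 1 -> measurable A' ->
    (mu2 (lin a' b' c' d' @^-1` A') = mu2 A')%E.
  move=> c0 det mA.
  have b'E : b' = (a' * d' - 1) / c' by rewrite -det; field.
  rewrite (_ : lin a' b' c' d' @^-1` A' = lin 1 ((d' - 1) / c') 0 1 @^-1`
     (lin 1 0 c' 1 @^-1` (lin 1 ((a' - 1) / c') 0 1 @^-1` A'))); last first.
    by rewrite !lin_preimage_comp b'E; apply: (congr1 (fun f => f @^-1` A')); apply: eq_lin; field.
  rewrite area_shear_x; last by do 2 apply: measurable_lin_preimage.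
  by rewrite area_shear_y ?area_shear_x //; apply: measurable_lin_preimage.
move=> det mA; have [c0|c0] := eqVneq c 0; last exact: main.
rewrite (_ : lin a b c d @^-1` A = lin a b a (b + d) @^-1` (lin 1 0 (-1) 1 @^-1` A)); last first.
  by rewrite lin_preimage_comp c0; apply: (congr1 (fun f => f @^-1` A)); apply: eq_lin; ring.
rewrite main ?area_shear_y //; last exact: measurable_lin_preimage.
  apply/eqP => a0; move: det; rewrite a0 c0 mul0r mulr0 subr0 => /esym/eqP.
  by rewrite oner_eq0.
by rewrite -det c0; ring.
Qed.

(** Measurability on [R * R] refers to the product sigma-algebra, so [U] is exhausted by the
    countably many rational squares it contains. *)
Lemma open_measurable2 (U : set (R * R)) : open U -> measurable U.
Proof.
move=> oU.
pose B (q : rat * rat * rat) : set (R * R) :=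
  ball (ratr q.1.1 : R) (ratr q.2) `*` ball (ratr q.1.2 : R) (ratr q.2).
pose B' q := if asbool (B q `<=` U) then B q else set0.
suff -> : U = \bigcup_q B' q.
  apply: countable_bigcupT_measurable; first exact: countableP.
  move=> q; rewrite /B'; case: ifPn => // _.
  by apply: measurableX; exact: measurable_ball.
apply/seteqP; split; last first.
  by move=> p [q _]; rewrite /B'; case: ifPn => // /asboolP; apply.
move=> [x y] Up.
have /nbhs_ballP [e /= e0 eU] : nbhs (x, y) U by exact: open_nbhs_nbhs.
have [r] := rat_in_itvoo (divr_gt0 e0 (ltr0n _ 2 : 0 < 2%:R :> R)).
rewrite in_itv /= => /andP[r0 re].
have H (z : R) : exists q : rat, `|ratr q - z| < ratr r.
  have zlt : z - ratr r < z + ratr r by lra.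
  have [q] := rat_in_itvoo zlt; rewrite in_itv /= => /andP[h1 h2].
  by exists q; rewrite ltr_norml; apply/andP; split; lra.
have [q1 h1] := H x; have [q2 h2] := H y.
exists (q1, q2, r) => //; rewrite /B'; case: ifPn => [_|/asboolP[]].
  by split; rewrite /= -ball_normE /ball_ /=.
move=> [x' y'] [/=]; rewrite -!ball_normE /ball_ /= => k1 k2; apply: eU; split => /=.
- rewrite -ball_normE /ball_ /=.
  rewrite (_ : x - x' = (x - ratr q1) + (ratr q1 - x')); last ring.
  rewrite (le_lt_trans (ler_normD _ _)) // [e]splitr ltrD //.
    by rewrite distrC (lt_trans h1).
  by rewrite (lt_trans k1).
- rewrite -ball_normE /ball_ /=.
  rewrite (_ : y - y' = (y - ratr q2) + (ratr q2 - y')); last ring.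
  rewrite (le_lt_trans (ler_normD _ _)) // [e]splitr ltrD //.
    by rewrite distrC (lt_trans h2).
  by rewrite (lt_trans k2).
Qed.

Lemma closed_measurable2 (C : set (R * R)) : closed C -> measurable C.
Proof. by move=> /closed_openC/open_measurable2/measurableC; rewrite setCK. Qed.

End Linear.

(** * The ellipses in slope coordinates *)

Section Rho.
Context {R : realType} (al be : R) (hab : al ^+ 2 + be ^+ 2 = 1).

(* Along the direction of slope [m], the unit vector of polar angle [theta] has doubled angle
   [(1 - m ^+ 2, 2 * m) / (1 + m ^+ 2)]; [xi] and [zeta] are the cosine and sine of [2 theta],
   shifted by the phase of [(al, be)]. The ellipse [exp r X^2 + exp (- r) Y^2 <= 1], in axes
   rotated by half that phase and with [exp r = (1 + tau) / (1 - tau)], is [x ^+ 2 <= rho tau m] at [(x, x * m)]. *)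
Definition xi (m : R) : R := (al * (1 - m ^+ 2) + 2 * be * m) / (1 + m ^+ 2).
Definition zeta (m : R) : R := (2 * al * m - be * (1 - m ^+ 2)) / (1 + m ^+ 2).
Definition rho (tau m : R) : R :=
  (1 - tau ^+ 2) / ((1 + m ^+ 2) * (1 + tau ^+ 2 + 2 * tau * xi m)).

Lemma add1sqr_gt0 (m : R) : 0 < 1 + m ^+ 2.
Proof. by rewrite ltr_pwDl // sqr_ge0. Qed.

Lemma add1sqr_neq0 (m : R) : 1 + m ^+ 2 != 0.
Proof. exact/lt0r_neq0/add1sqr_gt0. Qed.

Lemma xi_zeta m : xi m ^+ 2 + zeta m ^+ 2 = 1.
Proof.
have m0 := add1sqr_neq0 m.
rewrite /xi /zeta.
transitivity ((al ^+ 2 + be ^+ 2) * ((1 - m ^+ 2) ^+ 2 + (2 * m) ^+ 2) / (1 + m ^+ 2) ^+ 2).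
  by field.
by rewrite hab; field.
Qed.

Lemma xi_norm m : `|xi m| <= 1.
Proof.
rewrite -[leRHS]normr1 -ler_sqr ?nnegrE ?normr_ge0 // !real_normK ?num_real //.
by rewrite expr1n -(xi_zeta m) lerDl sqr_ge0.
Qed.

Lemma xi_bounds m : -1 <= xi m <= 1.
Proof. by rewrite -ler_norml xi_norm. Qed.

Lemma rho0E m : rho 0 m = (1 + m ^+ 2)^-1.
Proof. by rewrite /rho expr0n /= mulr0 mul0r !addr0 subr0 mulr1 div1r. Qed.

Lemma rho0_gt0 m : 0 < rho 0 m.
Proof. by rewrite rho0E invr_gt0 add1sqr_gt0. Qed.

Lemma rho0_le1 m : rho 0 m <= 1.
Proof. by rewrite rho0E invf_le1 ?add1sqr_gt0 // lerDl sqr_ge0. Qed.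

(** The denominator is at least [(1 - |tau|) ^+ 2]. *)
Lemma rho_den_ge (tau m : R) : `|tau| <= 1 / 2 -> 1 / 4 <= 1 + tau ^+ 2 + 2 * tau * xi m.
Proof.
rewrite ler_norml => /andP[t1 t2]; have /andP[x1 x2] := xi_bounds m.
have [t0|t0] := lerP 0 tau; nra.
Qed.

Lemma rhoE tau m : rho tau m = rho 0 m * ((1 - tau ^+ 2) / (1 + tau ^+ 2 + 2 * tau * xi m)).
Proof. by rewrite rho0E /rho invfM mulrC -!mulrA [_^-1 * (1 - _)]mulrC mulrCA. Qed.

Lemma rho_ge0 (tau m : R) : `|tau| <= 1 / 2 -> 0 <= rho tau m.
Proof.
move=> t; rewrite rhoE mulr_ge0 ?(ltW (rho0_gt0 m)) // divr_ge0 //.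
  move: t; rewrite ler_norml => /andP[t1 t2]; nra.
by have := rho_den_ge m t; lra.
Qed.

Lemma rho_le (tau m : R) : `|tau| <= 1 / 2 -> rho tau m <= 4 * rho 0 m.
Proof.
move=> t; rewrite rhoE mulrC ler_wpM2r ?(ltW (rho0_gt0 m)) //.
have := rho_den_ge m t => D.
rewrite ler_pdivrMr; [nra|lra].
Qed.

(** [rho tau / rho 0] is a Poisson kernel in the doubled angle, so its coefficients are Chebyshev
    polynomials in [xi]. The remainder is [tau ^+ 3] times a quotient with numerator at most 16 and
    denominator at least 1/4, whence 64. *)
Lemma rho_taylor (tau m : R) : `|tau| <= 1 / 2 ->
  `|rho tau m - rho 0 m * (1 - 2 * tau * xi m + (4 * xi m ^+ 2 - 2) * tau ^+ 2)|
  <= 64 * `|tau| ^+ 3.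
Proof.
move=> t; have D := rho_den_ge m t.
have D0 : 1 + tau ^+ 2 + 2 * tau * xi m != 0 by apply: lt0r_neq0; lra.
rewrite rhoE -mulrBr normrM ger0_norm ?(ltW (rho0_gt0 m)) //.
have -> : (1 - tau ^+ 2) / (1 + tau ^+ 2 + 2 * tau * xi m) -
   (1 - 2 * tau * xi m + (4 * xi m ^+ 2 - 2) * tau ^+ 2) =
   tau ^+ 3 * (- ((8 * xi m ^+ 3 - 6 * xi m) + (4 * xi m ^+ 2 - 2) * tau)
    / (1 + tau ^+ 2 + 2 * tau * xi m)) by field.
rewrite normrM normrX mulrCA [64 * _]mulrC ler_wpM2l ?exprn_ge0 //.
rewrite -[leRHS]mul1r ler_pM ?(ltW (rho0_gt0 m)) ?rho0_le1 //.
rewrite normrM normfV [`|1 + _ + _|]gtr0_norm; last lra.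
rewrite ler_pdivrMr; last lra.
have : `|- (8 * xi m ^+ 3 - 6 * xi m + (4 * xi m ^+ 2 - 2) * tau)| <= 16; last lra.
have /andP[x1 x2] := xi_bounds m.
move: t; rewrite ler_norml => /andP[t1 t2]; rewrite ler_norml.
have x3 : -1 <= xi m ^+ 3 <= 1 by apply/andP; split; nra.
have x4 : 0 <= xi m ^+ 2 <= 1 by apply/andP; split; nra.
by case/andP: x3 => ? ?; case/andP: x4 => ? ?; apply/andP; split; nra.
Qed.

Lemma continuous_add1sqr : continuous (fun m : R => 1 + m ^+ 2).
Proof. by move=> m; apply: cvgD; [exact: cvg_cst|exact: exprn_continuous]. Qed.

Lemma continuous_xi : continuous xi.
Proof.
move=> m; apply: cvgM; last by apply: cvgV; [exact: add1sqr_neq0|exact: continuous_add1sqr].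
apply: cvgD; apply: cvgM; try exact: cvg_cst; last exact: cvg_id.
by apply: cvgB; [exact: cvg_cst|exact: exprn_continuous].
Qed.

Lemma continuous_rho (tau : R) : `|tau| <= 1 / 2 -> continuous (rho tau).
Proof.
move=> t m; apply: cvgM; first exact: cvg_cst.
have D := rho_den_ge m t.
apply: cvgV; first by rewrite mulf_neq0 ?add1sqr_neq0 //; apply: lt0r_neq0; lra.
apply: cvgM; first exact: continuous_add1sqr.
apply: cvgD; first exact: cvg_cst.
by apply: cvgM; [exact: cvg_cst|exact: continuous_xi].
Qed.

End Rho.

(** * Integrals over the line of slopes *)

Section Integrals.
Context {R : realType}.
Notation mu := (@lebesgue_measure R).

Lemma integral_oneDsqrV : (\int[mu]_m ((1 + m ^+ 2)^-1)%:E = pi%:E)%E.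
Proof.
rewrite ge0_symfun_integralT.
- rewrite -set_itvcy integral0y_oneDsqr -EFinM; congr EFin.
  by rewrite mulrCA divff ?mulr1 // pnatr_eq0.
- by move=> m; rewrite invr_ge0 ltW // add1sqr_gt0.
- by move=> m; apply: cvgV; [exact: add1sqr_neq0|exact: continuous_add1sqr].
- by move=> m /=; rewrite sqrrN.
Qed.

Lemma measurable_oneDsqrV : measurable_fun setT (fun m : R => (1 + m ^+ 2)^-1).
Proof.
apply: continuous_measurable_fun => m.
by apply: cvgV; [exact: add1sqr_neq0|exact: continuous_add1sqr].
Qed.

Lemma integrable_oneDsqrV :
  mu.-integrable setT (fun m => ((1 + m ^+ 2)^-1)%:E).
Proof.
apply/integrableP; split.
  by apply/measurable_EFinP; exact: measurable_oneDsqrV.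
under eq_integral do rewrite gee0_abs ?lee_fin ?invr_ge0 ?(ltW (add1sqr_gt0 _)) //.
by rewrite integral_oneDsqrV ltry.
Qed.

Lemma bounded_integrable (D : set R) (g : R -> R) (M : R) : measurable D ->
  (mu D < +oo)%E -> measurable_fun setT g -> (forall x, `|g x| <= M) ->
  mu.-integrable D (EFin \o g).
Proof.
move=> mD muD mg gM; apply: measurable_bounded_integrable => //.
  exact: measurable_funTS.
exists M; split; first exact: num_real.
by move=> N MN x _ /=; rewrite (le_trans (gM x)) // ltW.
Qed.

Lemma integrableD_EFin (D : set R) (f g : R -> R) : measurable D ->
  mu.-integrable D (EFin \o f) -> mu.-integrable D (EFin \o g) ->
  mu.-integrable D (EFin \o (fun x => f x + g x)).
Proof. by move=> mD hf hg; exact: (@integrableD _ _ _ mu D mD _ _ hf hg). Qed.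

Lemma integrableZl_EFin (D : set R) (k : R) (f : R -> R) : measurable D ->
  mu.-integrable D (EFin \o f) -> mu.-integrable D (EFin \o (fun x => k * f x)).
Proof. by move=> mD hf; exact: (@integrableZl _ _ _ mu D mD k _ hf). Qed.

Lemma integrableB_EFin (D : set R) (f g : R -> R) : measurable D ->
  mu.-integrable D (EFin \o f) -> mu.-integrable D (EFin \o g) ->
  mu.-integrable D (EFin \o (fun x => f x - g x)).
Proof. by move=> mD hf hg; exact: (@integrableB _ _ _ mu D mD _ _ hf hg). Qed.

Lemma le_Rintegral_subset (A B : set R) (g : R -> R) :
  measurable A -> measurable B -> A `<=` B -> mu.-integrable B (EFin \o g) ->
  (forall x, B x -> ~ A x -> g x <= 0) ->
  \int[mu]_(x in B) g x <= \int[mu]_(x in A) g x.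
Proof.
move=> mA mB AB ig g0.
have -> : B = A `|` (B `\` A) by rewrite setDUK.
rewrite Rintegral_setU //; last 3 first.
- exact: measurableD.
- by rewrite setDUK.
- by apply/disj_setPS => x [Ax []].
rewrite gerDl -oppr_ge0.
have -> : - (\int[mu]_(x in B `\` A) g x) = (\int[mu]_(x in B `\` A) (- g x)).
  under [RHS]eq_Rintegral do rewrite -mulN1r.
  rewrite RintegralZl ?mulN1r //; first exact: measurableD.
  by apply: integrableS ig => //; exact: measurableD.
by apply: Rintegral_ge0 => x [Bx nAx]; rewrite oppr_ge0; exact: g0.
Qed.

Lemma Rintegral_is_derive (f F : R -> R) (a b : R) : a <= b ->
  (forall x : R, is_derive x (1 : R) F (f x)) -> continuous f ->
  \int[mu]_(x in `]a, b[) f x = F b - F a.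
Proof.
move=> ab dF cf.
have mf : measurable_fun setT f by exact: continuous_measurable_fun.
rewrite /Rintegral integral_itv_obnd_cbnd.
  rewrite integral_itv_bndo_bndc ?(integral_is_derive ab dF cf) //.
  by apply/measurable_EFinP/measurable_funTS.
by apply/measurable_EFinP/measurable_funTS.
Qed.

End Integrals.

(** * The integrand of the intersection area and its second difference *)

Section Capped.
Context {R : realType} (al be : R) (hab : al ^+ 2 + be ^+ 2 = 1).
Context (w : R -> R) (mw : measurable_fun setT w) (w0 : forall m, 0 <= w m).
Notation mu := (@lebesgue_measure R).
Notation rho := (rho al be).
Notation xi := (xi al be).

Definition capped (tau m : R) : R := Num.min (rho tau m) (w m).

Lemma measurable_capped (tau : R) : `|tau| <= 1 / 2 -> measurable_fun setT (capped tau).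
Proof.
move=> t; apply: measurable_minr => //.
by apply: continuous_measurable_fun; exact: continuous_rho.
Qed.

Lemma capped_ge0 (tau m : R) : `|tau| <= 1 / 2 -> 0 <= capped tau m.
Proof. by move=> t; rewrite le_min rho_ge0 // w0. Qed.

Lemma integrable_capped (tau : R) : `|tau| <= 1 / 2 ->
  mu.-integrable setT (EFin \o capped tau).
Proof.
move=> t.
apply: (@le_integrable _ _ _ mu _ _ _ (fun m : R => (4 * (1 + m ^+ 2)^-1)%:E)) => //.
- by apply/measurable_EFinP; exact: measurable_capped.
- move=> m _ /=; rewrite !ger0_norm ?capped_ge0 //; last first.
    by rewrite mulr_ge0 ?invr_ge0 ?(ltW (add1sqr_gt0 _)).
  by rewrite lee_fin -(rho0E al be) (le_trans _ (rho_le hab m t)) // ge_min lexx.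
- exact: (integrableZl_EFin 4 measurableT integrable_oneDsqrV).
Qed.

(** Both signs of [tau] are competitors, and pairing them cancels the first-order terms on the
    contact set. *)
Definition diff2 (tau m : R) : R := capped tau m + capped (- tau) m - 2 * capped 0 m.

Lemma norm0_le_half : `|0 : R| <= 1 / 2.
Proof. by rewrite normr0 divr_ge0. Qed.

Lemma integrable_diff2 (D : set R) (tau : R) : `|tau| <= 1 / 2 -> measurable D ->
  mu.-integrable D (EFin \o diff2 tau).
Proof.
move=> t mD; apply: (@integrableS _ _ _ mu setT) => //.
apply: integrableB_EFin => //; last exact/integrableZl_EFin/integrable_capped/norm0_le_half.
by apply: integrableD_EFin => //; apply: integrable_capped => //; rewrite normrN.
Qed.

Lemma Rintegral_diff2 (tau : R) : `|tau| <= 1 / 2 ->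
  \int[mu]_m diff2 tau m = \int[mu]_m capped tau m + \int[mu]_m capped (- tau) m
    - 2 * \int[mu]_m capped 0 m.
Proof.
move=> t; have t' : `|- tau| <= 1 / 2 by rewrite normrN.
rewrite RintegralB //; last 2 first.
- by apply: integrableD_EFin => //; exact: integrable_capped.
- exact/integrableZl_EFin/integrable_capped/norm0_le_half.
have i0 := integrable_capped norm0_le_half.
rewrite RintegralD // ?RintegralZl //; exact: integrable_capped.
Qed.

(** Here [capped 0] equals [w], which caps both other terms. This is what allows dropping pieces off
    the contact set from upper bounds. *)
Lemma diff2_le0 (tau m : R) : w m <= rho 0 m -> diff2 tau m <= 0.
Proof.
move=> wr; rewrite /diff2 {3}/capped (min_idPr wr) subr_le0 mulr_natl mulr2n.
by apply: lerD; rewrite ge_min lexx orbT.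
Qed.

End Capped.

(** * Second-order gain at the end of a gap *)

Section Zone.
Context {R : realType}.
Notation mu := (@lebesgue_measure R).

(* one-sided neighbourhood of [e], to the right if [s = 1], to the left if [s = -1] *)
Definition zone (s e c : R) : set R := [set m | 0 < s * (m - e) < c].

Lemma zone_right (e c : R) : zone 1 e c = `]e, e + c[%classic.
Proof.
by apply/seteqP; split => m; rewrite /zone /= in_itv /= mul1r subr_gt0 ltrBlDl.
Qed.

Lemma zone_left (e c : R) : zone (-1) e c = `]e - c, e[%classic.
Proof.
apply/seteqP; split => m; rewrite /zone /= in_itv /= mulN1r opprB => /andP[h1 h2];
  apply/andP; split; lra.
Qed.

Lemma measurable_zone (s e c : R) : s = 1 \/ s = -1 -> measurable (zone s e c).
Proof. by move=> [] ->; rewrite ?zone_left ?zone_right; exact: measurable_itv. Qed.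

Lemma Rintegral_zone_affine (s e c k g : R) : s = 1 \/ s = -1 -> 0 <= c ->
  \int[mu]_(m in zone s e c) (k - g * (s * (m - e))) = k * c - g * c ^+ 2 / 2.
Proof.
have cts (f : R) : continuous (fun m : R => k - f * (m - e)).
  move=> m; apply: cvgB; first exact: cvg_cst.
  by apply: cvgM; [exact: cvg_cst|apply: cvgB; [exact: cvg_id|exact: cvg_cst]].
have der (f m : R) : is_derive m (1 : R) (fun m : R => k * m - f * (m - e) ^+ 2 / 2) (k - f * (m - e)).
  by apply: is_derive_eq; rewrite /GRing.scale /=; field.
move=> + c0; case=> ->.
- rewrite zone_right.
  under eq_Rintegral do rewrite mul1r.
  rewrite (Rintegral_is_derive _ (der g) (cts g)); last by lra.
  by field.
- rewrite zone_left.
  under eq_Rintegral do rewrite mulN1r mulrN -mulNr.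
  rewrite (Rintegral_is_derive _ (der (- g)) (cts (- g))); last by lra.
  by field.
Qed.

Lemma is_derive_littleo (f : R -> R) (e d : R) : is_derive e (1 : R) f d ->
  forall eps : R, 0 < eps -> exists2 c : R, 0 < c &
    forall m, `|m - e| < c -> `|f m - f e - d * (m - e)| <= eps * `|m - e|.
Proof.
move=> [df dE] eps eps0.
have : (fun h : R => h^-1 *: ((f \o shift e) (h *: (1 : R)) - f e)) @ 0^' --> d.
  by rewrite -dE; exact: df.
move=> /cvgrPdist_le /(_ _ eps0) [c /= c0 H].
exists c => // m mc; have [->|me] := eqVneq m e.
  by rewrite !subrr mulr0 subr0 normr0 mulr0.
have {}me : m - e != 0 by rewrite subr_eq0.
have := H (m - e); rewrite /ball_ /= sub0r normrN => /(_ mc me).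
rewrite /GRing.scale /= mulr1 subrK => h.
rewrite (_ : f m - f e - d * (m - e) = - (d - (m - e)^-1 * (f m - f e)) * (m - e)).
  by rewrite normrM normrN ler_wpM2r.
by field.
Qed.

Lemma continuous_eps (f : R -> R) (e : R) : {for e, continuous f} ->
  forall eps : R, 0 < eps -> exists2 c : R, 0 < c &
    forall m, `|m - e| < c -> `|f m - f e| <= eps.
Proof.
move=> /cvgrPdist_le cf eps eps0; have [c /= c0 H] := cf _ eps0.
exists c => // m mc; rewrite distrC; apply: H.
by rewrite /ball_ /= distrC.
Qed.

End Zone.

Section EndGain.
Context {R : realType} (al be : R) (hab : al ^+ 2 + be ^+ 2 = 1).
Context (w : R -> R) (mw : measurable_fun setT w) (w0 : forall m, 0 <= w m).
Notation mu := (@lebesgue_measure R).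
Notation rho := (rho al be).
Notation xi := (xi al be).
Notation capped := (capped al be w).
Notation diff2 := (diff2 al be w).

Lemma diff2_le_capped (tau t m : R) : t = tau \/ t = - tau -> w m <= rho 0 m ->
  diff2 tau m <= capped t m - w m.
Proof.
move=> ht wr; have -> : diff2 tau m = capped tau m + capped (- tau) m - 2 * w m.
  by rewrite /diff2 {3}/capped (min_idPr wr).
have h1 : capped tau m <= w m by rewrite /capped ge_min lexx orbT.
have h2 : capped (- tau) m <= w m by rewrite /capped ge_min lexx orbT.
by case: ht => ->; lra.
Qed.

(* Next to the end [e] the excess of [w] over [rho t], with [t] of the sign of [xi e], is at
   least a triangle of height [2 rho xi tau] and slope [sigma]. *)
Lemma end_gain (e s eta : R) (G : R -> R) (sigma : R) :
  s = 1 \/ s = -1 -> 0 < eta ->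
  (forall m, zone s e eta m -> w m <= rho 0 m) ->
  (forall m, zone s e eta m -> G m <= w m) ->
  G e = rho 0 e -> is_derive e (1 : R) (fun m => rho 0 m - G m) (s * sigma) ->
  0 < sigma ->
  forall eps : R, 0 < eps -> exists2 d : R, 0 < d & forall tau : R, 0 < tau < d ->
    \int[mu]_(m in zone s e eta) diff2 tau m
      <= - tau ^+ 2 * (2 * rho 0 e ^+ 2 * xi e ^+ 2 / sigma - eps).
Proof.
move=> hs eta0 wrho Gw Ge dG sigma0 eps eps0.
have s2 : s * s = 1 by case: hs => ->; ring.
(* If [xi e = 0] the triangle degenerates and [diff2_le0] suffices. *)
have [x0|x0] := eqVneq (xi e) 0.
  exists (1 / 2); first lra.
  move=> tau /andP[t0 t1].
  rewrite x0 expr0n /= mulr0 mul0r sub0r mulrN mulNr opprK.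
  apply: (@le_trans _ _ 0); last by rewrite mulr_ge0 ?sqr_ge0 // ltW.
  apply: (le_trans (@le_Rintegral_subset _ set0 _ _ _ _ _ _ _)) => //.
  - exact: measurable_zone.
  - by apply: integrable_diff2 => //; [rewrite gtr0_norm //; lra|exact: measurable_zone].
  - by move=> m zm _; apply: diff2_le0; exact: wrho.
  - by rewrite Rintegral_set0.
have r0 := rho0_gt0 al be e.
have X0 : 0 < `|xi e| by rewrite normr_gt0.
set r := rho 0 e in r0 *; set X : R := `|xi e| in X0.
(* To leading order the triangle has height [A * tau] and base [a * tau], hence area
   [A ^+ 2 * tau ^+ 2 / (2 * sigma)]. *)
have [A AE] : exists A, A = 2 * r * X by exists (2 * r * X).
have [a aE] : exists a, a = A / sigma by exists (A / sigma).
have A0 : 0 < A by rewrite AE; apply: mulr_gt0 => //; apply: mulr_gt0.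
have a0 : 0 < a by rewrite aE divr_gt0.
have [c1 c10 H1] := is_derive_littleo dG (divr_gt0 eps0 (mulr_gt0 (ltr0n R 3 : 0 < 3) (exprn_gt0 2 a0))).
have cc : {for e, continuous (fun m => rho 0 m * xi m)}.
  by apply: cvgM; [apply: continuous_rho => //; exact: norm0_le_half|exact: continuous_xi].
have [c2 c20 H2] := continuous_eps cc (divr_gt0 eps0 (mulr_gt0 (ltr0n R 6 : 0 < 6) a0)).
(* One third of [eps] goes to the linearisation of [rho 0 - G], one to the variation of
   [rho 0 * xi], one to the quadratic and cubic terms. In the last, 34 is 2 from the Taylor
   coefficient plus half of 64, and 102 is three times 34. *)
pose d := Num.min (Num.min (1 / 2) (eps / (102 * a))) (Num.min (eta / a) (Num.min (c1 / a) (c2 / a))).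
exists d.
  by rewrite /d !lt_min !divr_gt0 // mulr_gt0.
move=> tau /andP[tau0]; rewrite /d !lt_min => /andP[/andP[t2 te] /andP[teta /andP[tc1 tc2]]].
have {}te : tau * a * 34 < eps / 3.
  move: te; rewrite ltr_pdivlMr ?mulr_gt0 //.
  lra.
move: teta tc1 tc2; rewrite !ltr_pdivlMr // => teta tc1 tc2.
(* The sign for which the ellipse recedes in the direction of slope [e]. *)
pose t := if 0 < xi e then tau else - tau.
have tE : t = tau \/ t = - tau by rewrite /t; case: ifP; [left|right].
have tX : t * xi e = tau * X.
  rewrite /t /X; case: ltrP => xe; first by rewrite gtr0_norm.
  by rewrite ler0_norm // mulrN mulNr.
have tn : `|t| = tau by case: tE => ->; rewrite ?normrN gtr0_norm.
have tt : `|t| <= 1 / 2 by rewrite tn; lra.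
have t22 : t ^+ 2 = tau ^+ 2 by case: tE => ->; rewrite ?sqrrN.
have mz : measurable (zone s e eta) by exact: measurable_zone.
have mz' : measurable (zone s e (tau * a)) by exact: measurable_zone.
have zz : zone s e (tau * a) `<=` zone s e eta.
  by move=> m /andP[h1 h2]; apply/andP; split => //; apply: lt_trans teta.
have tau2 : `|tau| <= 1 / 2 by rewrite gtr0_norm //; lra.
apply: (le_trans (le_Rintegral_subset mz' mz zz _ _)).
- exact: integrable_diff2.
- by move=> m zm _; apply: diff2_le0; exact: wrho.
have [E EE] : exists E, E = eps / (3 * a) by exists (eps / (3 * a)).
have E0 : 0 < E by rewrite EE divr_gt0 // mulr_gt0.
have pt (m : R) : zone s e (tau * a) m ->
    diff2 tau m <= - (A - E - E - 34 * tau) * tau - (- sigma) * (s * (m - e)).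
  move=> zm.
  have /andP[u0 ua] := zm.
  have um : `|m - e| = s * (m - e).
    rewrite -[RHS]gtr0_norm // normrM.
    by case: hs => ->; rewrite ?normrN normr1 mul1r.
  have [u uE] : exists u, u = s * (m - e) by exists (s * (m - e)).
  rewrite -uE in u0 ua um *.
  have h1 := diff2_le_capped tE (wrho _ (zz _ zm)).
  have h2 := Gw _ (zz _ zm).
  have h3 : capped t m <= rho t m by rewrite /capped ge_min lexx.
  have h4 := le_trans (ler_norm _) (rho_taylor hab m tt); rewrite tn t22 in h4.
  have h5 : rho 0 m - G m - sigma * u <= E * tau.
    have mc1 : `|m - e| < c1 by rewrite um (lt_trans ua).
    have := le_trans (ler_norm _) (H1 m mc1).
    rewrite Ge subrr subr0 um -mulrA -[s * (sigma * _)]mulrCA -uE => h.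
    apply: (le_trans h).
    rewrite EE (_ : eps / (3 * a ^+ 2) = eps / (3 * a) / a); last first.
      by field; exact: lt0r_neq0.
    rewrite -mulrA ler_wpM2l ?(ltW E0) //; first by rewrite -EE ltW.
    by rewrite mulrC ler_pdivrMr // ltW.
  have h6 : t * (rho 0 m * xi m) >= tau * r * X - tau * (E / 2).
    have mc2 : `|m - e| < c2 by rewrite um (lt_trans ua).
    have hh := H2 m mc2.
    have h : `|t * (rho 0 m * xi m - rho 0 e * xi e)| <= tau * (E / 2).
      rewrite normrM tn ler_pM2l //; apply: (le_trans hh).
      by rewrite EE le_eqVlt; apply/orP; left; apply/eqP; field; exact: lt0r_neq0.
    move: h; rewrite ler_norml => /andP[h _].
    have -> : tau * r * X = t * (rho 0 e * xi e) by rewrite mulrAC -tX -/r; ring.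
    by move: h; rewrite mulrBr; lra.
  have h7 : rho 0 m * (4 * xi m ^+ 2 - 2) <= 2.
    have x1 : 4 * xi m ^+ 2 - 2 <= 2.
      by have : xi m ^+ 2 <= 1; [rewrite -(xi_zeta hab m) lerDl sqr_ge0|lra].
    have p0 := rho0_gt0 al be m; have p1 := rho0_le1 al be m.
    by apply: (le_trans (ler_wpM2l (ltW p0) x1)); lra.
  have h8 : tau ^+ 3 <= tau ^+ 2 / 2 by rewrite exprS; nra.
  have h9 : rho 0 m * (4 * xi m ^+ 2 - 2) * tau ^+ 2 <= 2 * tau ^+ 2 by rewrite ler_wpM2r ?sqr_ge0.
  rewrite AE.
  have e1 : rho 0 m * (1 - 2 * t * xi m + (4 * xi m ^+ 2 - 2) * tau ^+ 2) =
    rho 0 m - 2 * (t * (rho 0 m * xi m)) + rho 0 m * (4 * xi m ^+ 2 - 2) * tau ^+ 2 by ring.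
  have e2 : - (2 * r * X - E - E - 34 * tau) * tau - - sigma * u =
    - 2 * (tau * r * X) + 2 * (E * tau) + 34 * tau ^+ 2 + sigma * u by ring.
  by rewrite e2; rewrite e1 in h4; lra.
have -> : - tau ^+ 2 * (2 * r ^+ 2 * xi e ^+ 2 / sigma - eps) =
    - tau ^+ 2 * (A * a - sigma * a ^+ 2 / 2 - eps).
  have -> : xi e ^+ 2 = X ^+ 2 by rewrite /X real_normK ?num_real.
  by rewrite aE AE; field; exact: lt0r_neq0.
have ta0 : 0 <= tau * a by rewrite mulr_ge0 // ltW.
apply: (le_trans (@le_Rintegral _ _ _ mu _ _ _ mz' _ _ pt)).
- exact: integrable_diff2.
- apply: (@integrableS _ _ _ mu `[e - tau * a, e + tau * a]%classic) => //.
  + move=> m /andP[h1 h2]; rewrite /= in_itv /=.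
    by apply/andP; split; case: hs h1 h2 => -> h1 h2; lra.
  + apply: continuous_compact_integrable; first exact: segment_compact.
    apply: continuous_subspaceT => m; apply: cvgB; first exact: cvg_cst.
    apply: cvgM; first exact: cvg_cst.
    by apply: cvgM; [exact: cvg_cst|apply: cvgB; [exact: cvg_id|exact: cvg_cst]].
rewrite Rintegral_zone_affine //.
have -> : - (A - E - E - 34 * tau) * tau * (tau * a) - - sigma * (tau * a) ^+ 2 / 2 =
  - tau ^+ 2 * (A * a - sigma * a ^+ 2 / 2 - (2 * (E * a) + tau * a * 34)) by ring.
rewrite !mulNr lerN2 ler_wpM2l ?sqr_ge0 // lerB //.
have -> : E * a = eps / 3 by rewrite EE; field; exact: lt0r_neq0.
by lra.
Qed.

End EndGain.

(** * Gain of a gap of the contact set *)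

Section GapAlgebra.
Context {R : realType} (al be : R) (hab : al ^+ 2 + be ^+ 2 = 1).
Notation xi := (xi al be).
Notation zeta := (zeta al be).

(* The factor [(q - p) / ...] is the cotangent of half the angle between the directions of slopes
   [p] and [q], i.e. of the angle at which their chord meets the unit circle. *)
Definition gap_gain (p q : R) : R :=
  (q - p) / (Num.sqrt (1 + p ^+ 2) * Num.sqrt (1 + q ^+ 2) - 1 - p * q)
  * (xi p ^+ 2 + xi q ^+ 2).

(* Primitives of [xi m / (1 + m ^+ 2)] and [(2 * xi m ^+ 2 - 1) / (1 + m ^+ 2)]. *)
Definition first_prim (m : R) : R := zeta m / 2.
Definition second_prim (m : R) : R := xi m * zeta m / 2.

(* [a, b] stand for the square roots, [c] and [s] for the cosine and sine of the angle
   between the directions of slopes [p] and [q], [C] and [Sn] for the cosine and sine of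
   twice the angle of their bisector. *)
Lemma gap_trig (p q a b : R) : 0 < a -> 0 < b -> a ^+ 2 = 1 + p ^+ 2 -> b ^+ 2 = 1 + q ^+ 2 ->
  let c := (1 + p * q) / (a * b) in let s := (q - p) / (a * b) in
  let C := (al * (1 - p * q) + be * (p + q)) / (a * b) in
  let Sn := (al * (p + q) - be * (1 - p * q)) / (a * b) in
  [/\ c ^+ 2 + s ^+ 2 = 1, C ^+ 2 + Sn ^+ 2 = 1,
      xi p = C * c + Sn * s /\ xi q = C * c - Sn * s &
      zeta p = Sn * c - C * s /\ zeta q = Sn * c + C * s].
Proof.
move=> a0 b0 a2 b2 c s C Sn.
have an := lt0r_neq0 a0; have bn := lt0r_neq0 b0.
have ab2 : (a * b) ^+ 2 = (1 + p ^+ 2) * (1 + q ^+ 2) by rewrite exprMn a2 b2.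
have p2 := add1sqr_neq0 p; have q2 := add1sqr_neq0 q.
have sq (u v : R) : u / (a * b) * (v / (a * b)) = u * v / ((1 + p ^+ 2) * (1 + q ^+ 2)).
  by rewrite -ab2; field; rewrite an bn.
split.
- by rewrite !expr2 /c /s !sq; field; rewrite p2 q2.
- rewrite !expr2 /C /Sn !sq.
  transitivity ((al ^+ 2 + be ^+ 2) * (1 + p ^+ 2) * (1 + q ^+ 2) / ((1 + p ^+ 2) * (1 + q ^+ 2))).
    by field; rewrite p2 q2.
  by rewrite hab; field; rewrite p2 q2.
- by split; rewrite /xi /C /c /Sn /s !sq; field; rewrite ?p2 ?q2.
- by split; rewrite /zeta /C /c /Sn /s !sq; field; rewrite ?p2 ?q2.
Qed.

(* With the notation of [gap_trig], [first_prim] increases by [C s] and the difference of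
   the two sides is [2 s (1 - c) (1 - C^2 + C^2 c^2 / (1 - c)^2)]. *)
Lemma gap_gain_ge (p q : R) : p < q -> 0 <= 1 + p * q ->
  4 * (1 + p * q) / (q - p) * (first_prim q - first_prim p) ^+ 2
  <= gap_gain p q + 4 * (second_prim q - second_prim p).
Proof.
move=> pq pq1.
rewrite /gap_gain; set a := Num.sqrt (1 + p ^+ 2); set b := Num.sqrt (1 + q ^+ 2).
have a0 : 0 < a by rewrite sqrtr_gt0 add1sqr_gt0.
have b0 : 0 < b by rewrite sqrtr_gt0 add1sqr_gt0.
have a2 : a ^+ 2 = 1 + p ^+ 2 by rewrite sqr_sqrtr // ltW // add1sqr_gt0.
have b2 : b ^+ 2 = 1 + q ^+ 2 by rewrite sqr_sqrtr // ltW // add1sqr_gt0.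
have [] := gap_trig a0 b0 a2 b2.
have [c cE] : exists c, c = (1 + p * q) / (a * b) by exists ((1 + p * q) / (a * b)).
have [s sE] : exists s, s = (q - p) / (a * b) by exists ((q - p) / (a * b)).
rewrite /= -cE -sE.
set C := (_ + be * _) / _; set Sn := (_ - be * _) / _.
move=> cs CS [xp xq] [zp zq].
have ab0 : 0 < a * b by rewrite mulr_gt0.
have c0 : 0 <= c by rewrite cE divr_ge0 // ltW.
have s0 : 0 < s by rewrite sE divr_gt0 //; lra.
have c1 : c < 1 by nra.
have qpE : q - p = s * (a * b) by rewrite sE divfK // lt0r_neq0.
have cE' : 1 + p * q = c * (a * b) by rewrite cE divfK // lt0r_neq0.
have -> : a * b - 1 - p * q = (1 - c) * (a * b) by rewrite mulrBl mul1r -cE'; ring.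
rewrite cE' qpE /first_prim /second_prim xp xq zp zq.
have s0' := lt0r_neq0 s0.
have c1' : 1 - c != 0 by apply: lt0r_neq0; lra.
have ab' := lt0r_neq0 ab0.
have S2 : Sn ^+ 2 = 1 - C ^+ 2 by rewrite -CS; ring.
have s2 : s ^+ 2 = 1 - c ^+ 2 by rewrite -cs; ring.
rewrite -subr_ge0.
have -> : s * (a * b) / ((1 - c) * (a * b)) *
    ((C * c + Sn * s) ^+ 2 + (C * c - Sn * s) ^+ 2) +
    4 * ((C * c - Sn * s) * (Sn * c + C * s) / 2 - (C * c + Sn * s) * (Sn * c - C * s) / 2) -
    4 * (c * (a * b)) / (s * (a * b)) * ((Sn * c + C * s) / 2 - (Sn * c - C * s) / 2) ^+ 2 =
    2 * s * ((C ^+ 2 * c ^+ 2 + Sn ^+ 2 * s ^+ 2) / (1 - c) + 2 * c * (C ^+ 2 - Sn ^+ 2) - 2 * c * C ^+ 2).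
  by field; rewrite s0' c1' lt0r_neq0 // lt0r_neq0.
rewrite S2 s2.
have -> : (C ^+ 2 * c ^+ 2 + (1 - C ^+ 2) * (1 - c ^+ 2)) / (1 - c) +
    2 * c * (C ^+ 2 - (1 - C ^+ 2)) - 2 * c * C ^+ 2 =
    ((1 - C ^+ 2) * (1 - c) ^+ 2 + C ^+ 2 * c ^+ 2) / (1 - c) by field.
rewrite -S2; apply: mulr_ge0; first by apply: mulr_ge0 => //; exact: ltW.
by apply: divr_ge0; [apply: addr_ge0; apply: mulr_ge0; exact: sqr_ge0|lra].
Qed.

(** By completing the square, the square in [gap_gain_ge] is bounded below by a tangent line. The
    result is the increment of a single function, so it sums over gaps to an integral. *)
Lemma gap_gain_ge_affine (p q la del : R) : p < q -> 0 < del -> del <= 1 + p * q ->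
  - 4 * (second_prim q - second_prim p) + 8 * la * (first_prim q - first_prim p)
   - 4 * la ^+ 2 / del * (q - p) <= gap_gain p q.
Proof.
move=> pq del0 delpq.
have := gap_gain_ge pq (le_trans (ltW del0) delpq).
set X := first_prim q - first_prim p; set Y := second_prim q - second_prim p => H.
have qp0 : 0 < q - p by lra.
suff : 8 * la * X - 4 * la ^+ 2 / del * (q - p) <= 4 * (1 + p * q) / (q - p) * X ^+ 2 by lra.
apply: (@le_trans _ _ (4 * del / (q - p) * X ^+ 2)); last first.
  by rewrite ler_wpM2r ?sqr_ge0 // ler_pM2r ?invr_gt0 // ler_pM2l.
rewrite -subr_ge0.
have -> : 4 * del / (q - p) * X ^+ 2 - (8 * la * X - 4 * la ^+ 2 / del * (q - p)) =
  4 * (del * X - la * (q - p)) ^+ 2 / (del * (q - p)).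
  by field; rewrite !lt0r_neq0.
by apply: divr_ge0; [apply: mulr_ge0 => //; exact: sqr_ge0|apply: mulr_ge0; exact: ltW].
Qed.

(* The gain of the outer gap, bounded by the directions of slopes [P] and [- P] and
   containing the vertical one. *)
Definition outer_gain (P : R) : R := P * (xi P ^+ 2 + xi (- P) ^+ 2).

Lemma outer_first (P : R) :
  first_prim P - first_prim (- P) = 2 * al * P / (1 + P ^+ 2).
Proof.
have P0 := add1sqr_neq0 P.
by rewrite /first_prim /zeta sqrrN; field.
Qed.

(** The identity behind [gap_gain_ge], for the outer gap: [c = (P^2 - 1) / (1 + P^2)],
    [s = 2 P / (1 + P^2)], [C^2 = al^2]. The primitives agree at both infinities, so their increment
    over the outer gap is minus the one over [[- P, P]]. For [P < 1] the square on the left is what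
    an obtuse gap loses. *)
Lemma outer_total (P : R) : 0 < P ->
  outer_gain P - 4 * (second_prim P - second_prim (- P)) +
    4 * (1 - P ^+ 2) / (2 * P) * (first_prim P - first_prim (- P)) ^+ 2 =
  4 * P / (1 + P ^+ 2) ^+ 2 * (2 * (1 - al ^+ 2) + al ^+ 2 * (1 - P ^+ 2) ^+ 2 / 2).
Proof.
move=> P0; have P1 := add1sqr_neq0 P.
rewrite outer_first /outer_gain /second_prim /xi /zeta !sqrrN.
have -> : 1 - al ^+ 2 = be ^+ 2 by rewrite -hab; ring.
have Pn := lt0r_neq0 P0.
by field; rewrite ?P1 ?Pn.
Qed.

End GapAlgebra.

Section Gaps.
Context {R : realType} (al be : R) (hab : al ^+ 2 + be ^+ 2 = 1).
Context (w : R -> R) (mw : measurable_fun setT w) (w0 : forall m, 0 <= w m).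
Notation mu := (@lebesgue_measure R).
Notation rho := (rho al be).
Notation xi := (xi al be).
Notation diff2 := (diff2 al be w).
Notation gap_gain := (gap_gain al be).

(** The ray of slope [m] meets the line [c * x + d * y = k] at abscissa [k / (c + d * m)]; the
    square is that line in slope coordinates. *)
Lemma is_derive_rho0_sub (k c d e : R) : c + d * e != 0 ->
  is_derive e (1 : R) (fun m => rho 0 m - (k / (c + d * m)) ^+ 2)
    (- 2 * e / (1 + e ^+ 2) ^+ 2 + 2 * k ^+ 2 * d / (c + d * e) ^+ 3).
Proof.
move=> H; have e2 := add1sqr_neq0 e.
rewrite (_ : (fun m => _) = (fun m : R => (1 + m ^+ 2)^-1 - (k * (c + d * m)^-1) ^+ 2)); last first.
  by apply/funext => m; rewrite rho0E.
have d1 : is_derive e (1 : R) (fun m : R => (1 + m ^+ 2)^-1) (- (1 + e ^+ 2) ^- 2 *: (2 * e)).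
  apply: is_deriveV => //; apply: is_derive_eq; rewrite /GRing.scale /=; ring.
have d2 : is_derive e (1 : R) (fun m : R => (c + d * m)^-1) (- (c + d * e) ^- 2 *: d).
  apply: is_deriveV => //; apply: is_derive_eq; rewrite /GRing.scale /=; ring.
apply: is_derive_eq; rewrite /GRing.scale /=; field.
by rewrite H e2.
Qed.

Lemma gap_end_gain (e s eta k c d sigma : R) : s = 1 \/ s = -1 -> 0 < eta ->
  (forall m, zone s e eta m -> w m <= rho 0 m) ->
  (forall m, zone s e eta m -> (k / (c + d * m)) ^+ 2 <= w m) ->
  (c + d * e) ^+ 2 = k ^+ 2 * (1 + e ^+ 2) -> k != 0 ->
  s * sigma = - 2 * e / (1 + e ^+ 2) ^+ 2 + 2 * k ^+ 2 * d / (c + d * e) ^+ 3 ->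
  0 < sigma ->
  forall eps : R, 0 < eps -> exists2 del : R, 0 < del & forall tau : R, 0 < tau < del ->
    \int[mu]_(m in zone s e eta) diff2 tau m
      <= - tau ^+ 2 * (2 * xi e ^+ 2 / ((1 + e ^+ 2) ^+ 2 * sigma) - eps).
Proof.
move=> hs eta0 wr Gw Ge k0 sE sigma0 eps eps0.
have e2 := add1sqr_neq0 e.
have ce : c + d * e != 0.
  by rewrite -sqrf_eq0 Ge mulf_neq0 // sqrf_eq0.
have dG := is_derive_rho0_sub k ce; rewrite -sE in dG.
have Ge' : (k / (c + d * e)) ^+ 2 = rho 0 e.
  by rewrite expr_div_n Ge rho0E; field; rewrite e2 k0.
have [del d0 H] := end_gain hab mw w0 hs eta0 wr Gw Ge' dG sigma0 eps0.
exists del => // tau ht; apply: (le_trans (H _ ht)).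
rewrite rho0E le_eqVlt; apply/orP; left; apply/eqP; congr (_ * (_ - _)).
by field; rewrite e2 lt0r_neq0.
Qed.

(** What lies in [D] outside [A] and [B] is nonpositive by [diff2_le0]. Besides the two ends of a
    gap, this also joins successive gaps and the outer gap. *)
Lemma two_ends (A B D : set R) (ga gb : R) :
  measurable A -> measurable B -> measurable D -> A `|` B `<=` D -> [disjoint A & B] ->
  (forall m, D m -> w m <= rho 0 m) ->
  (forall eps : R, 0 < eps -> exists2 d : R, 0 < d & forall tau : R, 0 < tau < d ->
    \int[mu]_(m in A) diff2 tau m <= - tau ^+ 2 * (ga - eps)) ->
  (forall eps : R, 0 < eps -> exists2 d : R, 0 < d & forall tau : R, 0 < tau < d ->
    \int[mu]_(m in B) diff2 tau m <= - tau ^+ 2 * (gb - eps)) ->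
  forall eps : R, 0 < eps -> exists2 d : R, 0 < d & forall tau : R, 0 < tau < d ->
    \int[mu]_(m in D) diff2 tau m <= - tau ^+ 2 * (ga + gb - eps).
Proof.
move=> mA mB mD ABD dAB wr HA HB eps eps0.
have e20 : 0 < eps / 2 by lra.
have [d1 d10 H1] := HA _ e20; have [d2 d20 H2] := HB _ e20.
exists (Num.min (1 / 2) (Num.min d1 d2)); first by rewrite !lt_min d10 d20 andbT; lra.
move=> tau /andP[t0]; rewrite !lt_min => /andP[t2 /andP[td1 td2]].
have tt : `|tau| <= 1 / 2 by rewrite gtr0_norm //; lra.
have mAB : measurable (A `|` B) by exact: measurableU.
apply: (le_trans (le_Rintegral_subset mAB mD ABD _ _)).
- exact: integrable_diff2.
- by move=> m Dm _; apply: diff2_le0; exact: wr.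
rewrite Rintegral_setU //; last exact: integrable_diff2.
have := H1 tau; rewrite t0 td1 => /(_ isT); have := H2 tau; rewrite t0 td2 => /(_ isT).
by lra.
Qed.

Lemma sqrt_oneDsqr_gap (p q : R) : p != q ->
  0 < Num.sqrt (1 + p ^+ 2) * Num.sqrt (1 + q ^+ 2) - 1 - p * q.
Proof.
move=> pq; rewrite -addrA -opprD subr_gt0.
apply: (le_lt_trans (ler_norm _)).
rewrite -(@ltr_pXn2r _ 2) ?nnegrE ?mulr_ge0 ?sqrtr_ge0 // exprMn !sqr_sqrtr ?(ltW (add1sqr_gt0 _)) //.
rewrite real_normK ?num_real // -subr_gt0.
have -> : (1 + p ^+ 2) * (1 + q ^+ 2) - (1 + p * q) ^+ 2 = (p - q) ^+ 2 by ring.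
by rewrite exprn_even_gt0 //= subr_eq0.
Qed.

Lemma inner_gap (p q : R) : p < q ->
  (forall m, p < m < q -> w m <= rho 0 m) ->
  (forall m, p < m < q -> ((q - p) / (Num.sqrt (1 + p ^+ 2) * (q - m) + Num.sqrt (1 + q ^+ 2) * (m - p))) ^+ 2 <= w m) ->
  forall eps : R, 0 < eps -> exists2 d : R, 0 < d & forall tau : R, 0 < tau < d ->
    \int[mu]_(m in `]p, q[) diff2 tau m <= - tau ^+ 2 * (gap_gain p q - eps).
Proof.
move=> pq wr Gw.
have pq' : p != q by rewrite lt_eqF.
have ab1 := sqrt_oneDsqr_gap pq'.
rewrite /gap_gain.
move: ab1 Gw; set a := Num.sqrt (1 + p ^+ 2); set b := Num.sqrt (1 + q ^+ 2) => ab1 Gw eps eps0.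
have a0 : 0 < a by rewrite sqrtr_gt0 add1sqr_gt0.
have b0 : 0 < b by rewrite sqrtr_gt0 add1sqr_gt0.
have a2 : a ^+ 2 = 1 + p ^+ 2 by rewrite sqr_sqrtr // ltW // add1sqr_gt0.
have b2 : b ^+ 2 = 1 + q ^+ 2 by rewrite sqr_sqrtr // ltW // add1sqr_gt0.
have qp0 : 0 < q - p by lra.
have qpn := lt0r_neq0 qp0; have an := lt0r_neq0 a0; have bn := lt0r_neq0 b0.
have abn := lt0r_neq0 ab1.
(* The chord has equation [c * x + d * y = q - p]; [sp] and [sq] are the rates at which it separates
   from the circle at its ends. *)
pose c := a * q - b * p; pose d := b - a.
have lE m : c + d * m = a * (q - m) + b * (m - p) by rewrite /c /d; ring.
have cp : c + d * p = a * (q - p) by rewrite lE; ring.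
have cq : c + d * q = b * (q - p) by rewrite lE; ring.
pose sp := 2 * (a * b - 1 - p * q) / ((1 + p ^+ 2) ^+ 2 * (q - p)).
pose sq := 2 * (a * b - 1 - p * q) / ((1 + q ^+ 2) ^+ 2 * (q - p)).
have sp0 : 0 < sp by rewrite divr_gt0 ?mulr_gt0 ?exprn_gt0 ?add1sqr_gt0.
have sq0 : 0 < sq by rewrite divr_gt0 ?mulr_gt0 ?exprn_gt0 ?add1sqr_gt0.
have eta0 : 0 < (q - p) / 2 by lra.
have zp m : zone 1 p ((q - p) / 2) m -> p < m < q.
  by rewrite /zone /= mul1r => /andP[h1 h2]; apply/andP; split; lra.
have zq m : zone (-1) q ((q - p) / 2) m -> p < m < q.
  by rewrite /zone /= mulN1r => /andP[h1 h2]; apply/andP; split; lra.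
have Hp := @gap_end_gain p 1 _ (q - p) c d sp (or_introl erefl) eta0
  (fun m h => wr m (zp m h)) _ _ qpn _ sp0.
have Hq := @gap_end_gain q (-1) _ (q - p) c d sq (or_intror erefl) eta0
  (fun m h => wr m (zq m h)) _ _ qpn _ sq0.
have -> : (q - p) / (a * b - 1 - p * q) * (xi p ^+ 2 + xi q ^+ 2) =
   2 * xi p ^+ 2 / ((1 + p ^+ 2) ^+ 2 * sp) + 2 * xi q ^+ 2 / ((1 + q ^+ 2) ^+ 2 * sq).
  by rewrite /sp /sq; field; rewrite qpn abn !add1sqr_neq0.
apply: (@two_ends (zone 1 p ((q - p) / 2)) (zone (-1) q ((q - p) / 2))) => //.
- by apply: measurable_zone; left.
- by apply: measurable_zone; right.
- by move=> m /= [/zp|/zq]; rewrite in_itv.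
- apply/disj_setPS => m [/=]; rewrite /zone /= mul1r mulN1r => /andP[h1 h2] /andP[h3 h4]; lra.
- apply: Hp.
  + by move=> m /zp h; rewrite lE; exact: Gw.
  + by rewrite cp exprMn a2 mulrC.
  + rewrite cp mul1r /sp /d.
    have -> : (a * (q - p)) ^+ 3 = a * (1 + p ^+ 2) * (q - p) ^+ 3 by rewrite -a2; ring.
    have E : (b - a) / a = (a * b - (1 + p ^+ 2)) / (1 + p ^+ 2) by rewrite -a2; field.
    transitivity (- 2 * p / (1 + p ^+ 2) ^+ 2 + 2 * ((b - a) / a) / ((1 + p ^+ 2) * (q - p))).
      by rewrite E; field; rewrite qpn add1sqr_neq0.
    by field; rewrite qpn add1sqr_neq0 an.
- apply: Hq.
  + by move=> m /zq h; rewrite lE; exact: Gw.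
  + by rewrite cq exprMn b2 mulrC.
  + rewrite cq mulN1r /sq /d.
    have -> : (b * (q - p)) ^+ 3 = b * (1 + q ^+ 2) * (q - p) ^+ 3 by rewrite -b2; ring.
    have E : (b - a) / b = (1 + q ^+ 2 - a * b) / (1 + q ^+ 2) by rewrite -b2; field.
    transitivity (- 2 * q / (1 + q ^+ 2) ^+ 2 + 2 * ((b - a) / b) / ((1 + q ^+ 2) * (q - p))).
      by rewrite E; field; rewrite qpn add1sqr_neq0.
    by field; rewrite qpn add1sqr_neq0 bn.
Qed.

(** The chord is horizontal, at height [P / sqrt (1 + P^2)]. The gap runs through infinity, so its
    ends are approached from the right of [P] and the left of [- P]; the zone length 1 is
    arbitrary. *)
Lemma outer_gap (P : R) : 0 < P ->
  (forall m, P < `|m| -> w m <= rho 0 m) ->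
  (forall m, P < `|m| -> P ^+ 2 / ((1 + P ^+ 2) * m ^+ 2) <= w m) ->
  forall eps : R, 0 < eps -> exists2 d : R, 0 < d & forall tau : R, 0 < tau < d ->
    \int[mu]_(m in [set m | P < `|m|]) diff2 tau m <= - tau ^+ 2 * (outer_gain al be P - eps).
Proof.
move=> P0 wr Gw eps eps0; have P2 := add1sqr_neq0 P; have Pn := lt0r_neq0 P0.
pose k := P / Num.sqrt (1 + P ^+ 2).
have n0 : 0 < Num.sqrt (1 + P ^+ 2) by rewrite sqrtr_gt0 add1sqr_gt0.
have k2 : k ^+ 2 = P ^+ 2 / (1 + P ^+ 2).
  by rewrite expr_div_n sqr_sqrtr // ltW // add1sqr_gt0.
have kn : k != 0 by rewrite mulf_neq0 // invr_neq0 // lt0r_neq0.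
pose sg := 2 / (P * (1 + P ^+ 2) ^+ 2).
have sg0 : 0 < sg by rewrite divr_gt0 ?mulr_gt0 ?exprn_gt0 ?add1sqr_gt0.
have zp m : zone 1 P 1 m -> P < `|m|.
  rewrite /zone /= mul1r => /andP[h1 h2]; apply: lt_le_trans (ler_norm m); lra.
have zq m : zone (-1) (- P) 1 m -> P < `|m|.
  rewrite /zone /= mulN1r => /andP[h1 h2]; rewrite -normrN; apply: lt_le_trans (ler_norm _); lra.
have G m : P < `|m| -> (k / (0 + 1 * m)) ^+ 2 <= w m.
  move=> Pm; have m0 : m != 0 by rewrite -normr_gt0 (lt_trans P0).
  apply: le_trans (Gw _ Pm); rewrite expr_div_n k2 add0r mul1r le_eqVlt; apply/orP; left.
  by apply/eqP; field; rewrite P2 m0.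
have Hp := @gap_end_gain P 1 1 k 0 1 sg (or_introl erefl) ltr01
  (fun m h => wr m (zp m h)) (fun m h => G m (zp m h)) _ kn _ sg0.
have Hq := @gap_end_gain (- P) (-1) 1 k 0 1 sg (or_intror erefl) ltr01
  (fun m h => wr m (zq m h)) (fun m h => G m (zq m h)) _ kn _ sg0.
have -> : outer_gain al be P =
   2 * xi P ^+ 2 / ((1 + P ^+ 2) ^+ 2 * sg) + 2 * xi (- P) ^+ 2 / ((1 + (- P) ^+ 2) ^+ 2 * sg).
  by rewrite sqrrN /outer_gain /sg; field; rewrite Pn P2.
apply: (@two_ends (zone 1 P 1) (zone (-1) (- P) 1)) => //.
- by apply: measurable_zone; left.
- by apply: measurable_zone; right.
- apply: open_measurable.
  rewrite (_ : [set m | _] = (fun m : R => `|m|) @^-1` [set x | P < x]); last by [].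
  apply: open_comp; last exact: open_gt.
  by move=> m _; exact: norm_continuous.
- by move=> m /= [/zp|/zq].
- apply/disj_setPS => m [/=]; rewrite /zone /= mul1r mulN1r => /andP[h1 h2] /andP[h3 h4]; lra.
- apply: Hp.
  + by rewrite k2; field.
  + by rewrite k2 /sg; field; rewrite Pn P2.
- apply: Hq.
  + by rewrite k2; field; rewrite P2.
  + by rewrite k2 /sg; field; rewrite Pn P2.
Qed.

End Gaps.

(** * No critical configuration *)

Section Components.
Context {R : realType}.

(** An endpoint lying in [U] would belong to another component, which is open and would therefore
    meet this one. *)
Lemma open_component (U : set R) (I : nat -> set R) (a b : R) (n : nat) :
  (forall k, open (I k)) -> (forall k, is_interval (I k)) -> trivIset setT I ->
  U = \bigcup_k I k -> U `<=` `[a, b] -> I n !=set0 ->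
  exists p q, [/\ p < q, I n = `]p, q[%classic, ~ U p, ~ U q & a <= p /\ q <= b].
Proof.
move=> oI iI tI UE Uab [x0 Ix0].
have Ine : I n !=set0 by exists x0.
have IU : I n `<=` U by rewrite UE; exact: bigcup_sup.
have Iab x : I n x -> a <= x <= b by move=> /IU /Uab; rewrite /= in_itv.
have hs : has_sup (I n).
  by split; [exists x0|exists b => x /Iab /andP[]].
have hi : has_inf (I n).
  by split; [exists x0|exists a => x /Iab /andP[]].
pose p := inf (I n); pose q := sup (I n).
have opn x : I n x -> exists2 e : R, 0 < e & forall y, `|x - y| < e -> I n y.
  move=> Ix; have /nbhs_ballP[e /= e0 H] : nbhs x (I n) by exact: open_nbhs_nbhs.
  by exists e => // y xy; apply: H; rewrite -ball_normE.
have lep x : I n x -> p < x.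
  move=> Ix; have [e e0 H] := opn x Ix.
  have : p <= x - e / 2.
    apply: ge_inf; first by case: hi.
    by apply: H; rewrite opprB addrCA subrr addr0 gtr0_norm; lra.
  lra.
have geq x : I n x -> x < q.
  move=> Ix; have [e e0 H] := opn x Ix.
  have : x + e / 2 <= q.
    apply: ub_le_sup; first by case: hs.
    by apply: H; rewrite opprD addrA subrr add0r normrN gtr0_norm; lra.
  lra.
have pq : p < q by apply: lt_trans (lep _ Ix0) (geq _ Ix0).
have notU r : ~ I n r -> (forall e, 0 < e -> exists2 y, I n y & `|r - y| < e) -> ~ U r.
  move=> nIr H; rewrite UE => -[k _ Ikr].
  have kn : k != n by apply/eqP => kn; rewrite kn in Ikr.
  have /nbhs_ballP[e /= e0 He] : nbhs r (I k) by exact: open_nbhs_nbhs.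
  have [y Iny ry] := H e e0.
  have Iky : I k y by apply: He; rewrite -ball_normE.
  move/trivIsetP : tI => /(_ k n Logic.I Logic.I kn) /seteqP[+ _].
  by move=> /(_ y); apply; split.
exists p, q; split => //.
- apply/seteqP; split => x /=; rewrite in_itv /=.
    by move=> Ix; rewrite lep // geq.
  move=> /andP[px xq].
  have [y Iy yx] := inf_lt Ine px; have [z Iz xz] := sup_gt Ine xq.
  by apply: (iI n y z) => //; rewrite (ltW yx) (ltW xz).
- apply: notU; first by move=> /lep; rewrite ltxx.
  move=> e e0; have pe : p < p + e by lra.
  have [y Iy yx] := inf_lt Ine pe; exists y => //.
  by rewrite distrC ltr_norml; have := lep _ Iy => ?; apply/andP; split; lra.
- apply: notU; first by move=> /geq; rewrite ltxx.
  move=> e e0; have qe : q - e < q by lra.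
  have [y Iy yx] := sup_gt Ine qe; exists y => //.
  by rewrite ltr_norml; have := geq _ Iy => ?; apply/andP; split; lra.
- split.
    by apply: lb_le_inf; [exists x0|move=> x /Iab /andP[]].
  by apply: ge_sup; [exists x0|move=> x /Iab /andP[]].
Qed.

End Components.

Section Primitives.
Context {R : realType} (al be : R) (hab : al ^+ 2 + be ^+ 2 = 1).

Lemma is_derive_oneDsqrV (e : R) :
  is_derive e (1 : R) (fun m : R => (1 + m ^+ 2)^-1) (- (1 + e ^+ 2) ^- 2 *: (2 * e)).
Proof.
apply: is_deriveV; first exact: add1sqr_neq0.
by apply: is_derive_eq; rewrite /GRing.scale /=; ring.
Qed.

Lemma is_derive_zeta (e : R) :
  is_derive e (1 : R) (zeta al be) (2 * xi al be e / (1 + e ^+ 2)).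
Proof.
have d1 := is_derive_oneDsqrV e; have e2 := add1sqr_neq0 e.
by rewrite /zeta; apply: is_derive_eq; rewrite /GRing.scale /= /xi; field.
Qed.

Lemma is_derive_xi (e : R) :
  is_derive e (1 : R) (xi al be) (- 2 * zeta al be e / (1 + e ^+ 2)).
Proof.
have d1 := is_derive_oneDsqrV e; have e2 := add1sqr_neq0 e.
by rewrite /xi; apply: is_derive_eq; rewrite /GRing.scale /= /zeta; field.
Qed.

Lemma is_derive_first_prim (e : R) :
  is_derive e (1 : R) (first_prim al be) (xi al be e / (1 + e ^+ 2)).
Proof.
have d1 := is_derive_zeta e; have e2 := add1sqr_neq0 e.
by rewrite /first_prim; apply: is_derive_eq; rewrite /GRing.scale /=; field.
Qed.

Lemma is_derive_second_prim (e : R) :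
  is_derive e (1 : R) (second_prim al be) ((2 * xi al be e ^+ 2 - 1) / (1 + e ^+ 2)).
Proof.
have d1 := is_derive_zeta e; have d2 := is_derive_xi e; have e2 := add1sqr_neq0 e.
rewrite /second_prim; apply: is_derive_eq; rewrite /GRing.scale /=.
have -> : 2 * xi al be e ^+ 2 - 1 = xi al be e ^+ 2 - zeta al be e ^+ 2.
  by have := xi_zeta hab e; lra.
by field.
Qed.

End Primitives.

(* The slopes of the directions in which the boundary of the unit disk lies in the body. *)
Definition contact (R : realType) (w : R -> R) : set R := [set m : R | (1 + m ^+ 2)^-1 <= w m].

(** * First and second variation at a local minimum *)

Section Critical.
Context {R : realType} (al be : R) (hab : al ^+ 2 + be ^+ 2 = 1).
Context (w : R -> R) (mw : measurable_fun setT w) (w0 : forall m, 0 <= w m).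
Notation mu := (@lebesgue_measure R).
Notation rho := (rho al be).
Notation xi := (xi al be).
Notation capped := (capped al be w).
Notation diff2 := (diff2 al be w).
Notation gap_gain := (gap_gain al be).
Notation S := (contact w).

Context (P : R) (P0 : 0 < P).
Context (clS : closed S).
Context (S_le : forall m, P < `|m| -> w m < (1 + m ^+ 2)^-1).
Context (S_P : S P) (S_NP : S (- P)).
Context (outer_chord : forall m : R, P < `|m| -> P ^+ 2 / ((1 + P ^+ 2) * m ^+ 2) <= w m).
Context (inner_chord : forall p q : R, S p -> S q -> p < q -> forall m, p < m < q ->
  ((q - p) / (Num.sqrt (1 + p ^+ 2) * (q - m) + Num.sqrt (1 + q ^+ 2) * (m - p))) ^+ 2 <= w m).
Context (locmin : exists2 d : R, 0 < d &
  forall tau, `|tau| < d -> \int[mu]_m capped 0 m <= \int[mu]_m capped tau m).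

Lemma contact_sub_itv : S `<=` `[- P, P]%classic.
Proof.
rewrite /contact => m /= Sm; rewrite in_itv /= -ler_norml leNgt; apply/negP => /S_le.
by rewrite ltNge Sm.
Qed.

Lemma measurable_contact : measurable S.
Proof. exact: closed_measurable. Qed.

Lemma mu_contact_lty : (mu S < +oo)%E.
Proof.
apply: (@le_lt_trans _ _ (mu `[- P, P]%classic)).
  by apply: le_measure; rewrite ?inE; [exact: measurable_contact|exact: measurable_itv|exact: contact_sub_itv].
by rewrite lebesgue_measure_itv /=; case: ifP => _; rewrite -?EFinD ltry.
Qed.

Definition dens1 (m : R) : R := xi m / (1 + m ^+ 2).
Definition dens2 (m : R) : R := (2 * xi m ^+ 2 - 1) / (1 + m ^+ 2).

Lemma continuous_dens1 : continuous dens1.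
Proof.
move=> m; apply: cvgM; first exact: continuous_xi.
by apply: cvgV; [exact: add1sqr_neq0|exact: continuous_add1sqr].
Qed.

Lemma continuous_dens2 : continuous dens2.
Proof.
move=> m; apply: cvgM; last first.
  by apply: cvgV; [exact: add1sqr_neq0|exact: continuous_add1sqr].
apply: cvgB; last exact: cvg_cst.
apply: cvgM; first exact: cvg_cst.
by apply: (@continuous_comp _ _ _ xi (fun x => x ^+ 2)); [exact: continuous_xi|exact: exprn_continuous].
Qed.

Lemma dens1_norm m : `|dens1 m| <= 1.
Proof.
rewrite /dens1 normrM -[leRHS]mulr1 ler_pM // ?(xi_norm hab) //.
rewrite ger0_norm ?invr_ge0 ?(ltW (add1sqr_gt0 m)) //.
by rewrite invf_le1 ?add1sqr_gt0 // lerDl sqr_ge0.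
Qed.

Lemma dens2_norm m : `|dens2 m| <= 1.
Proof.
rewrite /dens2 normrM -[leRHS]mulr1 ler_pM //.
  have := xi_zeta hab m; have := sqr_ge0 (xi m); have := sqr_ge0 (zeta al be m).
  by rewrite ler_norml => ? ? ?; apply/andP; split; lra.
rewrite ger0_norm ?invr_ge0 ?(ltW (add1sqr_gt0 m)) //.
by rewrite invf_le1 ?add1sqr_gt0 // lerDl sqr_ge0.
Qed.

Lemma integrable_dens1 (D : set R) : measurable D -> (mu D < +oo)%E ->
  mu.-integrable D (EFin \o dens1).
Proof.
move=> mD muD; apply: (bounded_integrable mD muD _ dens1_norm).
by apply: continuous_measurable_fun; exact: continuous_dens1.
Qed.

Lemma integrable_dens2 (D : set R) : measurable D -> (mu D < +oo)%E ->
  mu.-integrable D (EFin \o dens2).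
Proof.
move=> mD muD; apply: (bounded_integrable mD muD _ dens2_norm).
by apply: continuous_measurable_fun; exact: continuous_dens2.
Qed.

Lemma integrable_cst (D : set R) (k : R) : measurable D -> (mu D < +oo)%E ->
  mu.-integrable D (EFin \o (fun=> k)).
Proof.
move=> mD muD; apply: (@bounded_integrable _ D (fun=> k) `|k|) => //.
Qed.

Lemma capped0_contact m : S m -> capped 0 m = rho 0 m.
Proof. by rewrite /contact /= => Sm; rewrite /capped rho0E; exact/min_idPl. Qed.

Lemma off_contact_le m : ~ S m -> w m <= rho 0 m.
Proof. by rewrite /contact /= => /negP; rewrite -ltNge rho0E => /ltW. Qed.

(** Only the contact set can increase the integral: elsewhere [capped 0 = w] bounds [capped tau]. In
    the constant, 2 bounds the Taylor coefficient and 64 the remainder, as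
    [|tau| ^+ 3 <= tau ^+ 2]. *)
Lemma capped_sub_le (tau : R) : `|tau| <= 1 / 2 ->
  \int[mu]_m capped tau m - \int[mu]_m capped 0 m <=
  - 2 * tau * \int[mu]_(m in S) dens1 m + (2 + 64) * tau ^+ 2 * fine (mu S).
Proof.
move=> t.
have i0 := integrable_capped hab mw w0 (@norm0_le_half R).
have it := integrable_capped hab mw w0 t.
have iB := integrableB_EFin measurableT it i0.
have mS := measurable_contact.
rewrite -RintegralB //.
apply: (le_trans (le_Rintegral_subset mS measurableT _ iB _)) => //.
  move=> m _ /off_contact_le wr; rewrite subr_le0 /capped (min_idPr wr).
  by rewrite ge_min lexx orbT.
have id1 := integrable_dens1 mS mu_contact_lty.
have ic := integrable_cst ((2 + 64) * tau ^+ 2) mS mu_contact_lty.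
have id1' := integrableZl_EFin (- 2 * tau) mS id1.
apply: (@le_trans _ _ (\int[mu]_(m in S) (- 2 * tau * dens1 m + (2 + 64) * tau ^+ 2))).
  apply: le_Rintegral => //.
  - exact: integrableS iB.
  - exact: integrableD_EFin.
  move=> m Sm; rewrite (capped0_contact Sm).
  have h1 : capped tau m <= rho tau m by rewrite /capped ge_min lexx.
  have h2 := le_trans (ler_norm _) (rho_taylor hab m t).
  have h3 : rho 0 m * (4 * xi m ^+ 2 - 2) <= 2.
    have x1 : 4 * xi m ^+ 2 - 2 <= 2.
      by have : xi m ^+ 2 <= 1; [rewrite -(xi_zeta hab m) lerDl sqr_ge0|lra].
    have p0 := rho0_gt0 al be m; have p1 := rho0_le1 al be m.
    by apply: (le_trans (ler_wpM2l (ltW p0) x1)); lra.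
  have h4 : rho 0 m * (4 * xi m ^+ 2 - 2) * tau ^+ 2 <= 2 * tau ^+ 2 by rewrite ler_wpM2r ?sqr_ge0.
  have h5 : `|tau| ^+ 3 <= tau ^+ 2.
    rewrite exprSr real_normK ?num_real // -[leRHS]mulr1 ler_wpM2l ?sqr_ge0 //; lra.
  have e1 : rho 0 m * (1 - 2 * tau * xi m + (4 * xi m ^+ 2 - 2) * tau ^+ 2) =
    rho 0 m - 2 * tau * (xi m * rho 0 m) + rho 0 m * (4 * xi m ^+ 2 - 2) * tau ^+ 2 by ring.
  by rewrite /dens1 -[(1 + m ^+ 2)^-1](rho0E al be); rewrite e1 in h2; lra.
by rewrite RintegralD // Rintegral_cst // RintegralZl.
Qed.

(** An upper bound on the increment is enough because [tau] takes both signs: a nonzero moment would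
    make one of them decrease the integral. *)
Lemma first_order : \int[mu]_(m in S) dens1 m = 0.
Proof.
have [d d0 H] := locmin.
set M := \int[mu]_(m in S) dens1 m.
have key (s : R) : s = 1 \/ s = -1 -> 0 <= - s * M.
  move=> hs; rewrite leNgt; apply/negP => M0.
  pose c := (2 + 64) * fine (mu S).
  have c0 : 0 <= c by rewrite mulr_ge0 ?fine_ge0.
  (* This keeps the quadratic error below half of the linear term. *)
  pose tau := Num.min (Num.min (1 / 2) (d / 2)) (s * M / (c + 1)).
  have t0 : 0 < tau.
    by rewrite /tau !lt_min !divr_gt0 //=; [lra|lra].
  have t1 : tau <= 1 / 2 by rewrite /tau !ge_min lexx.
  have t2 : tau < d.
    by have : tau <= d / 2; [rewrite /tau !ge_min lexx orbT|lra].
  have t3 : tau * (c + 1) <= s * M.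
    by rewrite -ler_pdivlMr /tau ?ge_min ?lexx ?orbT //; lra.
  have st : `|s * tau| = tau by rewrite normrM (gtr0_norm t0); case: hs => ->; rewrite ?normrN normr1 mul1r.
  have st2 : (s * tau) ^+ 2 = tau ^+ 2 by rewrite exprMn; case: hs => ->; rewrite ?sqrrN expr1n mul1r.
  have := @capped_sub_le (s * tau); rewrite st st2 => /(_ t1).
  have := H (s * tau); rewrite st => /(_ t2).
  rewrite -/M => h1 h2.
  have h3 : 0 <= tau * (- 2 * (s * M) + tau * c).
    rewrite (_ : tau * _ = - 2 * (s * tau) * M + (2 + 64) * tau ^+ 2 * fine (mu S)); last by rewrite /c; ring.
    by lra.
  by move: h3; rewrite pmulr_rge0 //; nra.
have := key 1 (or_introl erefl); have := key (-1) (or_intror erefl); lra.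
Qed.

(** The linear terms cancel, two coefficients [4 * xi ^+ 2 - 2] add up to [4 * (2 * xi ^+ 2 - 1)],
    and two remainders give 128. *)
Lemma diff2_contact (tau : R) : `|tau| <= 1 / 2 ->
  \int[mu]_(m in S) diff2 tau m <=
  tau ^+ 2 * (4 * \int[mu]_(m in S) dens2 m) + 128 * `|tau| ^+ 3 * fine (mu S).
Proof.
move=> t; have mS := measurable_contact.
have id2 := integrable_dens2 mS mu_contact_lty.
have ic := integrable_cst (128 * `|tau| ^+ 3) mS mu_contact_lty.
have id2' := integrableZl_EFin (tau ^+ 2 * 4) mS id2.
apply: (@le_trans _ _ (\int[mu]_(m in S) (tau ^+ 2 * 4 * dens2 m + 128 * `|tau| ^+ 3))); last first.
  by rewrite RintegralD // Rintegral_cst // RintegralZl // [tau ^+ 2 * (4 * _)]mulrA.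
apply: le_Rintegral => //.
- exact: integrable_diff2.
- exact: integrableD_EFin.
move=> m Sm; rewrite /diff2 (capped0_contact Sm).
have h1 : capped tau m <= rho tau m by rewrite /capped ge_min lexx.
have h1' : capped (- tau) m <= rho (- tau) m by rewrite /capped ge_min lexx.
have h2 := le_trans (ler_norm _) (rho_taylor hab m t).
have t' : `|- tau| <= 1 / 2 by rewrite normrN.
have h2' := le_trans (ler_norm _) (rho_taylor hab m t'); rewrite normrN sqrrN in h2'.
rewrite /dens2 -[(1 + m ^+ 2)^-1](rho0E al be).
have e1 (u : R) : rho 0 m * (1 - 2 * u * xi m + (4 * xi m ^+ 2 - 2) * tau ^+ 2) =
  rho 0 m - 2 * u * (xi m * rho 0 m) + rho 0 m * (4 * xi m ^+ 2 - 2) * tau ^+ 2 by ring.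
rewrite !e1 in h2 h2'.
have -> : tau ^+ 2 * 4 * ((2 * xi m ^+ 2 - 1) * rho 0 m) =
  2 * (rho 0 m * (4 * xi m ^+ 2 - 2) * tau ^+ 2) by ring.
by lra.
Qed.

(* [la] is a Lagrange multiplier for [first_order]: its term integrates to [0] over the contact
   set. The term in [nu] pays for completing the square in [gap_gain_ge]. *)
Definition gap_bound (la nu p q : R) : R :=
  - 4 * (second_prim al be q - second_prim al be p)
  + 8 * la * (first_prim al be q - first_prim al be p) - nu * (q - p).

Section FinalInequality.
Context (la nu : R) (nu0 : 0 <= nu).
Context (gap_le : forall p q : R, S p -> S q -> p < q -> (forall m, p < m < q -> ~ S m) ->
  gap_bound la nu p q <= gap_gain p q).

Definition psi (m : R) : R := - 4 * dens2 m + 8 * la * dens1 m - nu.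

Lemma continuous_psi : continuous psi.
Proof.
move=> m; apply: cvgB; last exact: cvg_cst.
by apply: cvgD; (apply: cvgM; first exact: cvg_cst); [exact: continuous_dens2|exact: continuous_dens1].
Qed.

Lemma psi_norm m : `|psi m| <= 4 + 8 * `|la| + nu.
Proof.
rewrite /psi; move: (dens1_norm m) (dens2_norm m); move: (dens1 m) (dens2 m) => x y hx hy.
rewrite (le_trans (ler_normB _ _)) // (ger0_norm nu0) lerD2r.
rewrite (le_trans (ler_normD _ _)) // lerD // !normrM.
  by rewrite normrN [`|4|]ger0_norm // -[leRHS]mulr1 ler_wpM2l.
by rewrite [`|8|]ger0_norm // -[leRHS]mulr1 ler_wpM2l // mulr_ge0.
Qed.

Lemma integrable_psi (D : set R) : measurable D -> (mu D < +oo)%E ->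
  mu.-integrable D (EFin \o psi).
Proof.
move=> mD muD; apply: (bounded_integrable mD muD _ psi_norm).
by apply: continuous_measurable_fun; exact: continuous_psi.
Qed.

Lemma Rintegral_psi (p q : R) : p <= q ->
  \int[mu]_(m in `]p, q[) psi m = gap_bound la nu p q.
Proof.
move=> pq.
have dF (m : R) : is_derive m (1 : R)
    (fun m => - 4 * second_prim al be m + 8 * la * first_prim al be m - nu * m) (psi m).
  have d1 := is_derive_first_prim al be m; have d2 := is_derive_second_prim hab m.
  apply: is_derive_eq; rewrite /GRing.scale /= /psi /dens1 /dens2.
  by field; exact: add1sqr_neq0.
by rewrite (Rintegral_is_derive pq dF continuous_psi) /gap_bound; ring.
Qed.

Notation U := (`]- P, P[%classic `\` S).

Lemma open_gaps : open U.
Proof.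
rewrite setDE; apply: openI; first exact: interval_open.
exact: closed_openC.
Qed.

Notation I := (open_disjoint_itv open_gaps).
Notation V n := (\bigcup_(k < n) I k).

Lemma measurable_gap k : measurable (I k).
Proof. apply: open_measurable; exact: open_disjoint_itv_open. Qed.

Lemma measurable_gap_union n : measurable (V n).
Proof. by apply: bigcup_measurable => k _; exact: measurable_gap. Qed.

Lemma gap_sub k : I k `<=` U.
Proof. by rewrite [X in _ `<=` X](open_disjoint_itv_bigcup open_gaps); exact: bigcup_sup. Qed.

Lemma gap_union_sub n : V n `<=` U.
Proof. by apply: bigcup_sub => k _; exact: gap_sub. Qed.

Lemma gaps_sub_itv : U `<=` `[- P, P]%classic.
Proof. by move=> m [/=]; rewrite !in_itv /= => /andP[/ltW -> /ltW ->]. Qed.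

Lemma mu_itv_lty (D : set R) : measurable D -> D `<=` `[- P, P]%classic -> (mu D < +oo)%E.
Proof.
move=> mD DP; apply: (@le_lt_trans _ _ (mu `[- P, P]%classic)).
  by apply: le_measure; rewrite ?inE //; exact: measurable_itv.
by rewrite lebesgue_measure_itv /=; case: ifP => _; rewrite -?EFinD ltry.
Qed.

Lemma endpoint_contact r : - P <= r <= P -> ~ U r -> S r.
Proof.
move=> /andP[]; rewrite !le_eqVlt => /predU1P[<- _ _|r1]; first exact: S_NP.
move=> /predU1P[-> _|r2 nU]; first exact: S_P.
by apply: contrapT => nS; apply: nU; split => //=; rewrite in_itv /= r1 r2.
Qed.

Lemma gap_endpoints k : I k !=set0 -> exists p q : R,
  [/\ p < q, I k = `]p, q[%classic, S p, S q & forall m, p < m < q -> ~ S m].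
Proof.
move=> I0.
have [p [q [pq IE nUp nUq [Pp qP]]]] := open_component
  (@open_disjoint_itv_open _ _ open_gaps) (@open_disjoint_itv_is_interval _ _ open_gaps)
  (@open_disjoint_itv_trivIset _ _ open_gaps) (open_disjoint_itv_bigcup open_gaps) gaps_sub_itv I0.
exists p, q; split => //.
- by apply: endpoint_contact => //; apply/andP; split => //; lra.
- by apply: endpoint_contact => //; apply/andP; split => //; lra.
- move=> m pmq; have : I k m by rewrite IE /= in_itv.
  by move=> /gap_sub [].
Qed.

Lemma gap_diff2 k (eps : R) : 0 < eps -> exists2 d : R, 0 < d & forall tau : R, 0 < tau < d ->
  \int[mu]_(m in I k) diff2 tau m <= - tau ^+ 2 * (\int[mu]_(m in I k) psi m - eps).
Proof.
move=> eps0; have [->|I0] := eqVneq (I k) set0.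
  exists 1 => // tau _; rewrite !Rintegral_set0 sub0r mulrN mulNr opprK.
  by rewrite mulr_ge0 ?sqr_ge0 // ltW.
have /set0P/gap_endpoints[p [q [pq -> Sp Sq nS]]] := I0.
have [d d0 H] := inner_gap hab mw w0 pq (fun m h => off_contact_le (nS m h)) (inner_chord Sp Sq pq) eps0.
exists d => // tau ht; apply: (le_trans (H _ ht)).
rewrite !mulNr lerN2 ler_wpM2l ?sqr_ge0 // lerB // Rintegral_psi; last exact: ltW.
exact: gap_le.
Qed.

Lemma gap_union_le_rho0 n m : V n m -> w m <= rho 0 m.
Proof. by move=> /gap_union_sub[_]; exact: off_contact_le. Qed.

Lemma gap_unionS n : V n.+1 = V n `|` I n.
Proof. by rewrite bigcup_mkord big_ord_recr /= -bigcup_mkord. Qed.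

Lemma gap_union_disj n : [disjoint V n & I n].
Proof.
apply/disj_setPS => m [[k /= kn Ikm] Inm].
have := @open_disjoint_itv_trivIset _ _ open_gaps; move/trivIsetP => /(_ k n Logic.I Logic.I).
rewrite neq_ltn kn => /(_ isT) /seteqP[+ _].
by move=> /(_ m); apply; split.
Qed.

Lemma gap_union_diff2 n (eps : R) : 0 < eps -> exists2 d : R, 0 < d & forall tau : R, 0 < tau < d ->
  \int[mu]_(m in V n) diff2 tau m <= - tau ^+ 2 * (\int[mu]_(m in V n) psi m - eps).
Proof.
elim: n eps => [|n IH] eps eps0.
  exists 1 => // tau _; rewrite bigcup_mkord big_ord0 !Rintegral_set0 sub0r mulrN mulNr opprK.
  by rewrite mulr_ge0 ?sqr_ge0 // ltW.
have mVI : measurable (V n `|` I n) by apply: measurableU; [exact: measurable_gap_union|exact: measurable_gap].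
rewrite gap_unionS Rintegral_setU; last 4 first.
- exact: measurable_gap_union.
- exact: measurable_gap.
- apply: integrable_psi => //; apply: mu_itv_lty => //.
  by rewrite -gap_unionS; apply: subset_trans gaps_sub_itv; exact: gap_union_sub.
- exact: gap_union_disj.
apply: (two_ends hab mw w0 (A := V n) (B := I n)) => //.
- exact: measurable_gap_union.
- exact: measurable_gap.
- exact: gap_union_disj.
- by move=> m; rewrite -gap_unionS; exact: gap_union_le_rho0.
- exact: gap_diff2.
Qed.

(** Otherwise the second difference would be negative for small [tau], against minimality. Only
    finitely many gaps are taken because the threshold on [tau] depends on the gap. *)
Lemma gap_union_inequality n :
  outer_gain al be P + \int[mu]_(m in V n) psi m <= 4 * \int[mu]_(m in S) dens2 m.
Proof.
rewrite leNgt; apply/negP => lt.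
pose D := outer_gain al be P + \int[mu]_(m in V n) psi m - 4 * \int[mu]_(m in S) dens2 m.
have D0 : 0 < D by rewrite /D subr_gt0.
have e0 : 0 < D / 4 by rewrite divr_gt0.
pose O := [set m : R | P < `|m|].
have mO : measurable O.
  apply: open_measurable.
  rewrite (_ : O = (fun m : R => `|m|) @^-1` [set x | P < x]); last by [].
  apply: open_comp; last exact: open_gt.
  by move=> m _; exact: norm_continuous.
have O_le m : O m -> w m <= rho 0 m by move=> /S_le /ltW; rewrite rho0E.
have VO : [disjoint V n & O].
  apply/disj_setPS => m [/gap_union_sub[/= + _]]; rewrite /O /= in_itv /= -ltr_norml => h1 h2.
  by have := lt_trans h1 h2; rewrite ltxx.
have mV := measurable_gap_union n.
have mVO : measurable (V n `|` O) by exact: measurableU.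
have [d1 d10 H1] := two_ends hab mw w0 mV mO mVO (fun x h => h) VO
  (fun m h => match h with or_introl h => gap_union_le_rho0 h | or_intror h => O_le m h end)
  (@gap_union_diff2 n) (outer_gap hab mw w0 P0 O_le outer_chord) e0.
have [d d0 H] := locmin.
pose c := 128 * fine (mu S).
have c0 : 0 <= c by rewrite mulr_ge0 ?fine_ge0.
(* The errors of the gaps and the cubic terms each use at most [D / 4], which leaves a deficit of
   [D / 2]. *)
pose m0 := Num.min (Num.min (1 / 2) (d / 2)) (Num.min (d1 / 2) (D / 4 / (c + 1))).
have [tau [t0 [t1 [t2 [t3 t4]]]]] : exists tau : R,
   0 < tau /\ tau <= 1 / 2 /\ tau < d /\ tau < d1 /\ tau * (c + 1) <= D / 4.
  exists m0; split; first by rewrite /m0 !lt_min !divr_gt0 //; lra.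
  split; first by rewrite /m0 !ge_min lexx.
  split; first by have : m0 <= d / 2; [rewrite /m0 !ge_min lexx orbT|lra].
  split; first by have : m0 <= d1 / 2; [rewrite /m0 !ge_min lexx !orbT|lra].
  by rewrite -ler_pdivlMr ?/m0 ?ge_min ?lexx ?orbT //; lra.
have tn : `|tau| = tau by rewrite gtr0_norm.
have tt : `|tau| <= 1 / 2 by rewrite tn.
have := Rintegral_diff2 hab mw w0 tt.
have i1 : \int[mu]_m capped 0 m <= \int[mu]_m capped tau m by apply: H; rewrite tn.
have i2 : \int[mu]_m capped 0 m <= \int[mu]_m capped (- tau) m by apply: H; rewrite normrN tn.
move=> tot.
have {}tot : 0 <= \int[mu]_m diff2 tau m by rewrite tot; lra.
have mS := measurable_contact.
have SVO : [disjoint S & V n `|` O].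
  apply/disj_setPS => m [Sm []]; first by move=> /gap_union_sub[_].
  by move=> /S_le; rewrite ltNge; move: Sm; rewrite /contact /= => ->.
have mSVO : measurable (S `|` (V n `|` O)) by exact: measurableU.
have iJ := integrable_diff2 hab mw w0 tt measurableT.
have h1 : \int[mu]_m diff2 tau m <= \int[mu]_(m in S `|` (V n `|` O)) diff2 tau m.
  apply: le_Rintegral_subset => // m _ nm; apply: diff2_le0; apply: off_contact_le => Sm.
  by apply: nm; left.
rewrite Rintegral_setU // in h1; last exact: integrable_diff2.
have h2 := diff2_contact tt; rewrite tn in h2.
have h3 := H1 tau; rewrite t0 t3 in h3; move/(_ isT) in h3.
have h4 : 0 <= tau ^+ 2 * (tau * c - D + D / 4).
  have -> : tau ^+ 2 * (tau * c - D + D / 4) =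
     (tau ^+ 2 * (4 * \int[mu]_(m in S) dens2 m) + 128 * tau ^+ 3 * fine (mu S)) +
     (- tau ^+ 2 * (\int[mu]_(m in V n) psi m + outer_gain al be P - D / 4)).
    rewrite {1}/D /c; ring.
  by lra.
move: h4; rewrite pmulr_rge0 ?exprn_gt0 //; nra.
Qed.

Lemma measurable_gaps : measurable U.
Proof. by apply: open_measurable; exact: open_gaps. Qed.

(** [psi] is bounded and the measure of the remaining gaps tends to 0, so the inequality, now free
    of [tau], passes to the limit. *)
Lemma gaps_inequality :
  outer_gain al be P + \int[mu]_(m in U) psi m <= 4 * \int[mu]_(m in S) dens2 m.
Proof.
have arith (o a b c x d k : R) : 0 < d -> o + a - c = d -> x * (2 * k) < d ->
  a <= b + k * x -> o + b <= c -> False by lra.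
have mU := measurable_gaps.
have muU := mu_itv_lty mU gaps_sub_itv.
pose B := 4 + 8 * `|la| + nu.
have B0 : 0 < B by rewrite /B ltr_pwDl // ?addr_ge0 // ?mulr_ge0 // ltr_pwDl // mulr_ge0.
have UV n : mu (U `\` V n) = (mu U - mu (V n))%E.
  rewrite measureD //; last exact: measurable_gap_union.
  by rewrite (setIidr (@gap_union_sub n)).
have muV n : (mu (V n) < +oo)%E.
  by apply: mu_itv_lty (measurable_gap_union n) _; apply: subset_trans gaps_sub_itv; exact: gap_union_sub.
have step n : \int[mu]_(m in U) psi m <= \int[mu]_(m in V n) psi m + B * (fine (mu U) - fine (mu (V n))).
  have mVn := measurable_gap_union n.
  have mD : measurable (U `\` V n) by exact: measurableD.
  have UE : U = V n `|` (U `\` V n) by rewrite setDUK //; exact: gap_union_sub.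
  rewrite [X in \int[mu]_(_ in X) _]UE Rintegral_setU //; last 2 first.
  - by rewrite -UE; exact: integrable_psi.
  - by apply/disj_setPS => m [Vm []].
  rewrite lerD2l.
  have muD : (mu (U `\` V n) < +oo)%E.
    by apply: mu_itv_lty mD _; apply: subset_trans gaps_sub_itv; exact: subDsetl.
  apply: (@le_trans _ _ (\int[mu]_(m in U `\` V n) B)).
    apply: le_Rintegral => //.
    - exact: integrable_psi.
    - exact: integrable_cst.
    by move=> m _; exact: le_trans (ler_norm _) (psi_norm m).
  have fD : fine (mu (U `\` V n)) = fine (mu U) - fine (mu (V n)).
    by rewrite UV fineB // ge0_fin_numE.
  by rewrite Rintegral_cst // -fD.
rewrite leNgt; apply/negP => lt.
pose D := outer_gain al be P + \int[mu]_(m in U) psi m - 4 * \int[mu]_(m in S) dens2 m.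
have D0 : 0 < D by rewrite /D subr_gt0.
have cv : fine \o (mu \o (fun n => V n)) @ \oo --> fine (mu U).
  apply: fine_cvg.
  have UE : U = \bigcup_n V n.
    rewrite {1}(open_disjoint_itv_bigcup open_gaps); apply/seteqP; split.
      by move=> m [k _ Ik]; exists k.+1 => //; exists k => /=.
    by move=> m [n _ [k _ Ik]]; exists k.
  rewrite fineK ?ge0_fin_numE // {2}UE.
  apply: nondecreasing_cvg_mu.
  - by move=> n; exact: measurable_gap_union.
  - by rewrite -UE.
  - by move=> n n' nn'; apply/subsetPset => m [k /= kn Ik]; exists k => //=; exact: leq_trans nn'.
have e0 : 0 < D / (2 * B) by rewrite divr_gt0 // mulr_gt0.
have /cvgrPdist_lt /(_ _ e0) [n _ /(_ n (leqnn n))] := cv.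
rewrite /= => /(le_lt_trans (ler_norm _)); rewrite ltr_pdivlMr ?mulr_gt0 // => h.
exact: (arith _ _ _ _ _ _ _ D0 erefl h (step n) (gap_union_inequality n)).
Qed.

(** The integral of [psi] is explicit over [[- P, P]], and over the contact set it is [- 4] times
    that of [dens2] minus [nu * mu S], by [first_order]. The difference is the integral over the
    gaps; in [gaps_inequality] the terms in [dens2] cancel and [nu * mu S >= 0] has the good
    sign. *)
Lemma second_order :
  outer_gain al be P - 4 * (second_prim al be P - second_prim al be (- P))
  + 8 * la * (first_prim al be P - first_prim al be (- P)) - 2 * P * nu <= 0.
Proof.
have arith (o b d s a1 a2 : R) : 0 <= nu * s -> - 4 * d - nu * s + b =
  - 4 * a2 + 8 * la * a1 - nu * (P - - P) -> o + b <= 4 * d ->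
  o - 4 * a2 + 8 * la * a1 - 2 * P * nu <= 0 by lra.
have NPP : - P <= P by have P0' : 0 < P := P0; lra.
have mS := measurable_contact.
have mU := measurable_gaps.
have muU := mu_itv_lty mU gaps_sub_itv.
have SU : [disjoint S & U] by apply/disj_setPS => m [Sm []].
have E : S `|` U = `[- P, P]%classic.
  apply/seteqP; split => m.
    by move=> [/contact_sub_itv|/gaps_sub_itv].
  rewrite /= in_itv /= => mP; have [Sm|nS] := pselect (S m); first by left.
  by right; apply: contrapT => /(endpoint_contact mP).
have iE : mu.-integrable (S `|` U) (EFin \o psi).
  by apply: integrable_psi; rewrite E //; apply: mu_itv_lty => //; exact: measurable_itv.
have h1 : \int[mu]_(m in `[- P, P]) psi m = gap_bound la nu (- P) P.
  rewrite -Rintegral_psi; last exact: NPP.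
  rewrite -Rintegral_itv_bndo_bndc; last first.
    by apply: integrable_psi => //; apply: mu_itv_lty => // m; rewrite /= !in_itv /= => /andP[-> /ltW].
  rewrite Rintegral_itv_obnd_cbnd //.
  by apply: integrable_psi => //; apply: mu_itv_lty => // m; rewrite /= !in_itv /= => /andP[/ltW -> /ltW].
have h2 : \int[mu]_(m in S) psi m = - 4 * \int[mu]_(m in S) dens2 m - nu * fine (mu S).
  have i1 := integrableZl_EFin (8 * la) mS (integrable_dens1 mS mu_contact_lty).
  have i2 := integrableZl_EFin (- 4) mS (integrable_dens2 mS mu_contact_lty).
  have i3 := integrable_cst nu mS mu_contact_lty.
  have i12 := integrableD_EFin mS i2 i1.
  rewrite /psi RintegralB // RintegralD // Rintegral_cst // RintegralZl ?RintegralZl //.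
  - by rewrite first_order mulr0 addr0.
  - exact: integrable_dens2 mS mu_contact_lty.
  - exact: integrable_dens1 mS mu_contact_lty.
have h3 : \int[mu]_(m in S) psi m + \int[mu]_(m in U) psi m = gap_bound la nu (- P) P.
  by rewrite -h1 -E Rintegral_setU.
rewrite h2 in h3.
by apply: (arith _ _ _ _ _ _ _ h3 gaps_inequality); rewrite mulr_ge0 // fine_ge0.
Qed.

End FinalInequality.

Context (muS : (0 < mu S)%E).
Context (large_or_small : P <= 1 \/
  forall p q : R, S p -> S q -> p < q -> (forall m, p < m < q -> ~ S m) -> 0 <= 1 + p * q).

Lemma mu_cover (a b c d : R) : a <= b -> c <= d -> S `<=` `[a, b] `|` `[c, d] ->
  fine (mu S) <= (b - a) + (d - c).
Proof.
move=> ab cd Sab.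
have itv x y : x <= y -> mu `[x, y]%classic = (y - x)%:E.
  move=> xy; rewrite lebesgue_measure_itv /= lte_fin -EFinB.
  by case: ltrP => // yx; rewrite (le_anti (introT andP (conj xy yx))) subrr.
rewrite -lee_fin fineK; last by rewrite ge0_fin_numE // mu_contact_lty.
apply: (@le_trans _ _ (mu (`[a, b] `|` `[c, d])%classic)).
  apply: le_measure => //; rewrite inE; first exact: measurable_contact.
  by apply: measurableU; exact: measurable_itv.
rewrite EFinD -(itv _ _ ab) -(itv _ _ cd).
by apply: measureU2; exact: measurable_itv.
Qed.

Lemma no_critical : False.
Proof.
have P0' : 0 < P := P0.
have T := outer_total hab P0.
move: T; set X0 := first_prim al be P - first_prim al be (- P); set TR := 4 * P / _ * _ => T.
have X0E : X0 = 2 * al * P / (1 + P ^+ 2) := outer_first al be P.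
have P2 := add1sqr_gt0 P.
have al2 : 0 <= al ^+ 2 <= 1.
  by rewrite sqr_ge0 /= -hab lerDl sqr_ge0.
(* [TR] can vanish only if [al ^+ 2 = 1], and [X0] only if [al = 0]. *)
have pos (k : R) : 0 < k -> 0 < TR + k * X0 ^+ 2.
  move=> k0.
  have P4 : 0 < 4 * P / (1 + P ^+ 2) ^+ 2 by rewrite divr_gt0 ?mulr_gt0 ?exprn_gt0.
  have [a0|an] := eqVneq al 0.
    have X00 : X0 = 0 by rewrite X0E a0; ring.
    rewrite X00 /TR a0 !expr0n /= mul0r mul0r mulr0 !addr0 subr0 mulr1.
    exact: mulr_gt0.
  apply: ltr_wpDl.
    rewrite mulr_ge0 ?(ltW P4) //; case/andP: al2 => a1 a2.
    apply: addr_ge0; first by apply: mulr_ge0 => //; lra.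
    by apply: divr_ge0 => //; apply: mulr_ge0; exact: sqr_ge0.
  rewrite mulr_gt0 // exprn_even_gt0 //= X0E.
  by rewrite !mulf_eq0 !negb_or invr_eq0 an (lt0r_neq0 P0) add1sqr_neq0 pnatr_eq0.
have [P1|Pgt] := lerP P 1.
- pose sg := fine (mu S).
  have sg0 : 0 < sg by rewrite fine_gt0 // muS mu_contact_lty.
  have sgP : sg <= 2 * P.
    have : sg <= (P - - P) + (P - P); last by lra.
    by apply: mu_cover => //; [lra|move=> m /contact_sub_itv; left].
  (* An inner gap has length at most [2 * P - sg], which keeps [1 + p * q] above [del]. *)
  pose del := 1 - P ^+ 2 + P * sg / 2.
  have del0 : 0 < del by rewrite /del; nra.
  have gaps p q : S p -> S q -> p < q -> (forall m, p < m < q -> ~ S m) -> del <= 1 + p * q.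
    move=> Sp Sq pq nS.
    have /contact_sub_itv := Sp; have /contact_sub_itv := Sq; rewrite /= !in_itv /= => /andP[q1 q2] /andP[p1 p2].
    have pqsg : q - p <= 2 * P - sg.
      have : sg <= (p - - P) + (P - q); last by lra.
      apply: mu_cover => // m Sm; have /contact_sub_itv := Sm; rewrite /= !in_itv /= => /andP[m1 m2].
      have [mp|pm] := lerP m p; first by left; rewrite m1.
      have [qm|mq] := lerP q m; first by right.
      by exfalso; apply: (nS m) => //; rewrite pm mq.
    rewrite /del.
    have [p0|p0] := lerP 0 p; first by nra.
    have [q0|q0] := lerP q 0; first by nra.
    (* With 0 inside the gap, the smaller of [- p] and [q] is at most [P - sg / 2], the larger at
       most [P]. *)
    by have [?|?] := lerP (- p) q; nra.
  (* This multiplier maximises [8 * la * X0 - 2 * P * nu]. *)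
  pose la := X0 * del / (2 * P).
  pose nu := 4 * la ^+ 2 / del.
  have nu0 : 0 <= nu by rewrite divr_ge0 ?(ltW del0) // mulr_ge0 // sqr_ge0.
  have H := @second_order la nu nu0 (fun p q Sp Sq pq nS =>
     gap_gain_ge_affine hab la pq del0 (gaps p q Sp Sq pq nS)).
  rewrite -/X0 in H.
  (* The first term compensates the loss of the outer gap in [outer_total]; the second is the
     surplus fed to [pos]. *)
  have E : 8 * la * X0 - 2 * P * nu = 4 * (1 - P ^+ 2) / (2 * P) * X0 ^+ 2 + sg * X0 ^+ 2.
    transitivity (2 * del / P * X0 ^+ 2).
      by rewrite /nu /la; field; rewrite !lt0r_neq0.
    by rewrite /del; field; exact: lt0r_neq0.
  have := pos _ sg0; lra.
- case: large_or_small => [|gaps]; first by lra.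
  (* For [P > 1] the outer gap is acute and loses nothing, so the squares of the other gaps are
     dropped. *)
  have g p q : S p -> S q -> p < q -> (forall m, p < m < q -> ~ S m) ->
      gap_bound 0 0 p q <= gap_gain p q.
    move=> Sp Sq pq nS; have := gap_gain_ge hab pq (gaps p q Sp Sq pq nS).
    have : 0 <= 4 * (1 + p * q) / (q - p) * (first_prim al be q - first_prim al be p) ^+ 2.
      by rewrite mulr_ge0 ?sqr_ge0 // divr_ge0 ?mulr_ge0 ?gaps //; lra.
    by rewrite /gap_bound; lra.
  have H := second_order (lexx 0) g.
  have P21 : 1 < P ^+ 2 by nra.
  have E2 : 4 * (1 - P ^+ 2) / (2 * P) * X0 ^+ 2 = - (2 * (P ^+ 2 - 1) / P * X0 ^+ 2).
    by field; exact: lt0r_neq0.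
  have k0 : 0 < 2 * (P ^+ 2 - 1) / P by rewrite divr_gt0 // mulr_gt0 //; lra.
  rewrite E2 in T.
  have := pos _ k0; lra.
Qed.

End Critical.

(** * Symmetric bodies and their contact with the unit circle *)

Section Body.
Context {R : realType}.
Notation mu := (@lebesgue_measure R).
Notation mu2 := (mu \x mu)%E.
Implicit Types K : set (R * R).

(** These properties pass to preimages under unimodular linear maps. Allowing [a + b <= 1] combines
    convexity with [body0]. *)
Record sym_body K : Prop := SymBody {
  body_closed : closed K ;
  body_bounded : exists M : R, forall p, K p -> `|p.1| <= M /\ `|p.2| <= M ;
  body0 : K (0, 0) ;
  bodyN : forall x y, K (x, y) -> K (- x, - y) ;
  body_comb : forall p q a b, K p -> K q -> 0 <= a -> 0 <= b -> a + b <= 1 ->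
    K (a * p.1 + b * q.1, a * p.2 + b * q.2) }.

Lemma sym_body_convex_body K : convex_body K -> centrally_symmetric K -> sym_body K.
Proof.
move=> [cK vK [z Kz]] sK.
have clK : closed K by apply: compact_closed => //; exact: norm_hausdorff.
have N x y : K (x, y) -> K (- x, - y) by move=> Kxy; rewrite sK; exists (x, y).
have {}Kz : K z by exact: interior_subset.
have comb p q (a : R) : K p -> K q -> 0 <= a -> a <= 1 ->
    K (a * p.1 + (1 - a) * q.1, a * p.2 + (1 - a) * q.2).
  move=> Kp Kq a0 a1.
  have := vK p q (Itv01 a0 a1); rewrite !inE => /(_ Kp Kq).
  by case: p q {Kp Kq} => [p1 p2] [q1 q2].
have K0 : K (0, 0).
  have h1 : 0 <= 1 / 2 :> R by lra.
  have h2 : 1 / 2 <= 1 :> R by lra.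
  have := comb _ _ (1 / 2) Kz (N _ _ (eq_ind _ K Kz _ (surjective_pairing z))) h1 h2.
  by rewrite /= (_ : _ + _ = 0); [rewrite (_ : 1 / 2 * z.2 + _ = 0) //; field|field].
split => //.
- have [M [_ H]] := compact_bounded cK.
  exists (M + 1) => p Kp; have := H (M + 1) _ p Kp.
  rewrite ltrDl ltr01 => /(_ isT); rewrite /Num.norm /= ge_max => /andP[].
  by [].
- move=> p q a b Kp Kq a0 b0 ab1.
  have [b1|b1] := eqVneq b 1.
    have a00 : a = 0 by lra.
    by rewrite b1 a00 !mul0r !add0r !mul1r -surjective_pairing.
  have b10 : 0 < 1 - b by rewrite lt_neqAle subr_ge0 eq_sym subr_eq0 eq_sym b1 /=; lra.
  have h1 : 0 <= a / (1 - b) by rewrite divr_ge0 // ltW.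
  have h2 : a / (1 - b) <= 1 by rewrite ler_pdivrMr //; lra.
  have b1' : b <= 1 by lra.
  (* The point is [b] times [q] plus [1 - b] times a point of the segment from the origin to [p]. *)
  have := comb _ _ _ Kq (comb _ _ _ Kp K0 h1 h2) b0 b1'; rewrite /= !mulr0 !addr0.
  rewrite (_ : b * q.1 + _ = a * p.1 + b * q.1); last by field; exact: lt0r_neq0.
  by rewrite (_ : b * q.2 + _ = a * p.2 + b * q.2) //; field; exact: lt0r_neq0.
Qed.

Lemma continuous_lin (a b c d : R) : continuous (lin a b c d).
Proof.
have H (u v : R) : continuous (fun p : R * R => u * p.1 + v * p.2).
  move=> p; apply: cvgD; apply: cvgM; try exact: cvg_cst; [exact: cvg_fst|exact: cvg_snd].
by move=> p; exact: (cvg_pair (H a b p) (H c d p)).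
Qed.

Lemma sym_body_lin K (a b c d : R) : sym_body K -> a * d - b * c = 1 ->
  sym_body (lin a b c d @^-1` K).
Proof.
move=> [clK [M bK] K0 NK cK] det; split.
- apply: preimage_closed clK => p _; exact: continuous_lin.
- exists ((`|a| + `|b| + `|c| + `|d|) * M) => p /bK; rewrite /lin /=.
  set x := a * _ + _; set y := c * _ + _ => -[hx hy].
  have M0 : 0 <= M by apply: le_trans hx.
  have -> : p.1 = d * x - b * y by rewrite -[LHS]mul1r -det /x /y; ring.
  have -> : p.2 = a * y - c * x by rewrite -[LHS]mul1r -det /x /y; ring.
  have B (u v : R) : `|u * x - v * y| <= (`|u| + `|v|) * M.
    apply: (le_trans (ler_normB _ _)); rewrite !normrM mulrDl.
    by rewrite lerD // ler_wpM2l.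
  split.
    apply: (le_trans (B _ _)); rewrite ler_wpM2r //.
    by have := normr_ge0 a; have := normr_ge0 c; lra.
  rewrite distrC; apply: (le_trans (B _ _)); rewrite ler_wpM2r //.
  by have := normr_ge0 b; have := normr_ge0 d; lra.
- by rewrite /preimage /lin /= !mulr0 !addr0.
- by move=> x y; rewrite /preimage /lin /= !mulrN -!opprD; exact: NK.
- move=> p q u v; rewrite /preimage /lin /= => Kp Kq u0 v0 uv.
  have := cK _ _ _ _ Kp Kq u0 v0 uv; rewrite /=.
  rewrite (_ : u * (a * p.1 + b * p.2) + _ = a * (u * p.1 + v * q.1) + b * (u * p.2 + v * q.2)); last by ring.
  by rewrite (_ : u * (c * p.1 + d * p.2) + _ = c * (u * p.1 + v * q.1) + d * (u * p.2 + v * q.2)) //; ring.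
Qed.

(* The square of the abscissa at which the ray of slope [m] leaves [K]. *)
Definition reach K (m : R) : R := sup [set x | K (x, x * m)] ^+ 2.

Lemma reach_ge0 K m : 0 <= reach K m.
Proof. exact: sqr_ge0. Qed.

Lemma body_scale K x y a : sym_body K -> K (x, y) -> `|a| <= 1 -> K (a * x, a * y).
Proof.
move=> bK Kxy; rewrite ler_norml => /andP[a1 a2].
have [a0|a0] := lerP 0 a.
  have := body_comb bK Kxy (body0 bK) a0 (lexx 0); rewrite addr0 => /(_ a2) /=.
  by rewrite !mul0r !addr0.
have na0 : 0 <= - a by lra.
have na1 : - a + 0 <= 1 by lra.
have := body_comb bK (bodyN bK Kxy) (body0 bK) na0 (lexx 0) na1.
by rewrite /= !mul0r !addr0 !mulrNN.
Qed.

(** Closedness puts the point of the supremum in [K]; convexity and symmetry fill the segment to its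
    antipode. *)
Lemma reachP K x m : sym_body K -> K (x, x * m) <-> x ^+ 2 <= reach K m.
Proof.
move=> bK; set A := [set x | K (x, x * m)].
have A0 : A 0 by rewrite /A /= mul0r; exact: body0.
have [M bM] := body_bounded bK.
have hA : has_sup A.
  by split; [exists 0|exists M => y /bM[/= + _]; exact/le_trans/ler_norm].
have clA : closed A.
  apply: (@preimage_closed _ _ (fun x : R => (x, x * m))) (body_closed bK) => y _.
  have cm : {for y, continuous (fun x : R => x * m)}.
    by apply: cvgM; [exact: cvg_id|exact: cvg_cst].
  exact: (cvg_pair (@cvg_id _ (nbhs y)) cm).
have supA : A (sup A).
  by apply: clA; apply: closure_sup; [exists 0|case: hA].
have s0 : 0 <= sup A by apply: ub_le_sup; [case: hA|].
rewrite /reach -/A -[x ^+ 2]real_normK ?num_real // ler_sqr ?nnegrE //.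
split => [Ax|xs].
  apply: ub_le_sup; first by case: hA.
  have [->|->] : `|x| = x \/ `|x| = - x by case: (ger0P x); [left|right].
    exact: Ax.
  by rewrite /A /= mulNr; exact: bodyN.
have [s00|s00] := eqVneq (sup A) 0.
  by move: xs; rewrite s00 normr_le0 => /eqP ->; rewrite mul0r; exact: body0.
have sp : 0 < sup A by rewrite lt_neqAle eq_sym s00.
have : `|x / sup A| <= 1 by rewrite normrM normfV (ger0_norm s0) ler_pdivrMr // mul1r.
move=> /(body_scale bK supA); rewrite divfK // mulrA divfK //.
Qed.

Lemma area_reach K : sym_body K ->
  measurable_fun setT (reach K) /\ (mu2 K = \int[mu]_m (reach K m)%:E)%E.
Proof.
move=> bK; apply: area_slope; first by apply: closed_measurable2; exact: body_closed.
  exact: reach_ge0.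
by move=> x m; exact: reachP.
Qed.

(** A general [Q] serves the disk, the ellipses and their rotated copies at once. *)
Lemma area_reach_quad K (Q : R * R -> R) (q : R -> R) : sym_body K ->
  closed [set p | Q p <= 1] -> (forall m, 0 < q m) ->
  (forall x m, Q (x, x * m) = x ^+ 2 * q m) ->
  (mu2 ([set p | (Q p <= 1)%R] `&` K) = \int[mu]_m (Num.min (q m)^-1 (reach K m))%R%:E)%E.
Proof.
move=> bK clQ q0 Qq.
apply: (proj2 (area_slope _ _ _)).
- by apply: measurableI; apply: closed_measurable2 => //; exact: body_closed.
- by move=> m; rewrite le_min reach_ge0 invr_ge0 ltW.
- move=> x m; rewrite le_min -(rwP andP) -(reachP _ _ bK) /= Qq.
  by rewrite -[_ <= (q m)^-1](ler_pM2r (q0 m)) mulVf // lt0r_neq0.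
Qed.

Lemma closed_quad (a b c : R) : closed [set p : R * R | a * p.1 ^+ 2 + b * p.1 * p.2 + c * p.2 ^+ 2 <= 1].
Proof.
rewrite (_ : [set p | _] = (fun p : R * R => a * p.1 ^+ 2 + b * p.1 * p.2 + c * p.2 ^+ 2) @^-1` [set x | x <= 1]); last by [].
apply: preimage_closed; last exact: closed_le.
move=> p _; have f1 : fst @ nbhs p --> p.1 by exact: cvg_fst.
have f2 : snd @ nbhs p --> p.2 by exact: cvg_snd.
by do !apply: cvgD; do ?apply: cvgM; do ?exact: cvg_cst.
Qed.

End Body.

(** * Gaps as pairs of unit vectors *)

Section GapGeometry.
Context {R : realType}.
Notation mu := (@lebesgue_measure R).
Notation mu2 := (mu \x mu)%E.
Implicit Types (K : set (R * R)) (u v : R * R).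

Definition sqnorm u : R := u.1 ^+ 2 + u.2 ^+ 2.
Definition wedge u v : R := u.1 * v.2 - u.2 * v.1.
Definition inner u v : R := u.1 * v.1 + u.2 * v.2.
Definition comb (a : R) u (b : R) v : R * R := (a * u.1 + b * v.1, a * u.2 + b * v.2).
Definition rot (c s : R) : R * R -> R * R := lin c (- s) s c.

(* [u] and [v] are consecutive points of the unit circle in [K]. *)
Definition is_gap K u v : Prop :=
  [/\ sqnorm u = 1, sqnorm v = 1, K u /\ K v, 0 < wedge u v &
    forall a b, 0 < a -> 0 < b -> sqnorm (comb a u b v) = 1 -> ~ K (comb a u b v)].

Section Rotation.
Context (c s : R) (hcs : c ^+ 2 + s ^+ 2 = 1).

Lemma sqnorm_rot u : sqnorm (rot c s u) = sqnorm u.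
Proof.
rewrite /sqnorm /rot /lin /= -[RHS]mul1r -hcs; ring.
Qed.

Lemma wedge_rot u v : wedge (rot c s u) (rot c s v) = wedge u v.
Proof. by rewrite /wedge /rot /lin /= -[RHS]mul1r -hcs; ring. Qed.

Lemma inner_rot u v : inner (rot c s u) (rot c s v) = inner u v.
Proof. by rewrite /inner /rot /lin /= -[RHS]mul1r -hcs; ring. Qed.

Lemma comb_rot a u b v : comb a (rot c s u) b (rot c s v) = rot c s (comb a u b v).
Proof. by rewrite /comb /rot /lin /=; congr (_, _); ring. Qed.

Lemma is_gap_rot K u v :
  is_gap (rot c s @^-1` K) u v <-> is_gap K (rot c s u) (rot c s v).
Proof.
rewrite /is_gap !sqnorm_rot wedge_rot.
split => -[u1 v1 Kuv w0 H]; split => // a b a0 b0.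
  by rewrite comb_rot sqnorm_rot; exact: H.
by have := H a b a0 b0; rewrite comb_rot sqnorm_rot.
Qed.

Lemma sym_body_rot K : sym_body K -> sym_body (rot c s @^-1` K).
Proof. by move=> bK; apply: sym_body_lin => //; rewrite -hcs; ring. Qed.

End Rotation.

(** [rot c s] takes the vertical to the bisector of [u] and [v]; [X] and [Y] are the sine and cosine
    of half the angle of the gap. *)
Lemma gap_chart K u v : is_gap K u v -> exists c s X Y : R,
  [/\ c ^+ 2 + s ^+ 2 = 1, 0 < X, 0 < Y, Y ^+ 2 - X ^+ 2 = inner u v &
    is_gap (rot c s @^-1` K) (X, Y) (- X, Y)].
Proof.
move=> g; have [u1 v1 _ w0 _] := g.
pose n := Num.sqrt (sqnorm (comb 1 u 1 v)).
have e1 : sqnorm (comb 1 u 1 v) = 2 * (1 + inner u v).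
  transitivity (sqnorm u + sqnorm v + 2 * inner u v).
    by rewrite /sqnorm /comb /inner /=; ring.
  by rewrite u1 v1; ring.
have lag : inner u v ^+ 2 + wedge u v ^+ 2 = 1.
  transitivity (sqnorm u * sqnorm v); first by rewrite /sqnorm /inner /wedge; ring.
  by rewrite u1 v1 mulr1.
(* A positive wedge excludes antipodal vectors, so the bisector exists. *)
have i1 : 0 < 1 + inner u v by nra.
have n2 : n ^+ 2 = 2 * (1 + inner u v) by rewrite sqr_sqrtr e1 // mulr_ge0 // ltW.
have n0 : 0 < n by rewrite sqrtr_gt0 e1 mulr_gt0.
have nn := lt0r_neq0 n0.
pose c := (u.2 + v.2) / n; pose s := - (u.1 + v.1) / n.
have n2' : (u.2 + v.2) ^+ 2 + (u.1 + v.1) ^+ 2 = n ^+ 2.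
  by rewrite n2 -e1 /sqnorm /comb /= !mul1r addrC.
have hcs : c ^+ 2 + s ^+ 2 = 1.
  by rewrite /c /s !expr_div_n sqrrN -mulrDl n2' divff // expf_neq0.
have i1' := lt0r_neq0 i1.
have uv (x : R) (z : R) : z = x * (2 * (1 + inner u v)) + 0 -> z / n ^+ 2 = x.
  by rewrite addr0 => ->; rewrite n2 mulfK // mulf_neq0.
have un : 1 - sqnorm u = 0 by rewrite u1 subrr.
have vn : 1 - sqnorm v = 0 by rewrite v1 subrr.
exists c, s, (wedge u v / n), ((1 + inner u v) / n).
have uE : rot c s (wedge u v / n, (1 + inner u v) / n) = u.
  rewrite [RHS]surjective_pairing /rot /lin /= /c /s; congr (_, _).
    transitivity (((u.2 + v.2) * wedge u v + (u.1 + v.1) * (1 + inner u v)) / n ^+ 2); first by field.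
    apply: uv; transitivity (u.1 * (2 * (1 + inner u v)) + (v.1 * (1 - sqnorm u) - u.1 * (1 - sqnorm v))).
      by rewrite /wedge /inner /sqnorm; ring.
    by rewrite un vn !mulr0 subr0.
  transitivity ((- (u.1 + v.1) * wedge u v + (u.2 + v.2) * (1 + inner u v)) / n ^+ 2); first by field.
  apply: uv; transitivity (u.2 * (2 * (1 + inner u v)) + (v.2 * (1 - sqnorm u) - u.2 * (1 - sqnorm v))).
    by rewrite /wedge /inner /sqnorm; ring.
  by rewrite un vn !mulr0 subr0.
have vE : rot c s (- (wedge u v / n), (1 + inner u v) / n) = v.
  rewrite [RHS]surjective_pairing /rot /lin /= /c /s; congr (_, _).
    transitivity ((- (u.2 + v.2) * wedge u v + (u.1 + v.1) * (1 + inner u v)) / n ^+ 2); first by field.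
    apply: uv; transitivity (v.1 * (2 * (1 + inner u v)) - (v.1 * (1 - sqnorm u) - u.1 * (1 - sqnorm v))).
      by rewrite /wedge /inner /sqnorm; ring.
    by rewrite un vn !mulr0 subr0 oppr0.
  transitivity (((u.1 + v.1) * wedge u v + (u.2 + v.2) * (1 + inner u v)) / n ^+ 2); first by field.
  apply: uv; transitivity (v.2 * (2 * (1 + inner u v)) - (v.2 * (1 - sqnorm u) - u.2 * (1 - sqnorm v))).
    by rewrite /wedge /inner /sqnorm; ring.
  by rewrite un vn !mulr0 subr0 oppr0.
split => //.
- by rewrite divr_gt0.
- by rewrite divr_gt0.
- rewrite !expr_div_n -mulrBl; apply: uv.
  transitivity ((1 + inner u v) ^+ 2 - (1 - inner u v ^+ 2)); last by ring.
  by rewrite -lag; ring.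
- by apply/(is_gap_rot hcs); rewrite uE vE.
Qed.

Definition unit_dir (m : R) : R * R := (1 / Num.sqrt (1 + m ^+ 2), m / Num.sqrt (1 + m ^+ 2)).

Lemma sqnorm_unit_dir m : sqnorm (unit_dir m) = 1.
Proof.
rewrite /sqnorm /unit_dir /= !expr_div_n expr1n -mulrDl sqr_sqrtr ?divff ?add1sqr_neq0 //.
exact/ltW/add1sqr_gt0.
Qed.

Lemma contact_reach K m : sym_body K -> contact (reach K) m <-> K (unit_dir m).
Proof.
move=> bK; rewrite /contact /unit_dir /= [m / _]mulrC -[X in K (_, X * _)]mul1r reachP //.
rewrite expr_div_n expr1n sqr_sqrtr ?div1r //; exact/ltW/add1sqr_gt0.
Qed.

Lemma contact_ratio K x y : sym_body K -> K (x, y) -> sqnorm (x, y) = 1 -> x != 0 ->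
  contact (reach K) (y / x).
Proof.
move=> bK Kxy; rewrite /sqnorm /= => n1 x0; rewrite /contact /=.
rewrite (_ : (1 + (y / x) ^+ 2)^-1 = x ^+ 2); last first.
  rewrite (_ : 1 + (y / x) ^+ 2 = (x ^+ 2 + y ^+ 2) / x ^+ 2); last by field.
  by rewrite n1 div1r invrK.
by apply/reachP => //; rewrite mulrC divfK.
Qed.

Lemma closed_contact K : sym_body K -> closed (contact (reach K)).
Proof.
move=> bK; rewrite (_ : contact _ = unit_dir @^-1` K); last first.
  by apply/seteqP; split => m /(contact_reach _ bK).
apply: preimage_closed (body_closed bK) => m _.
have cs : {for m, continuous (fun m : R => (Num.sqrt (1 + m ^+ 2))^-1)}.
  apply: cvgV; first by rewrite lt0r_neq0 // sqrtr_gt0 add1sqr_gt0.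
  apply: (@continuous_comp _ _ _ (fun m : R => 1 + m ^+ 2) Num.sqrt).
    exact: continuous_add1sqr.
  exact: sqrt_continuous.
have c1 : {for m, continuous (fun m : R => 1 / Num.sqrt (1 + m ^+ 2))}.
  by apply: cvgM => //; exact: cvg_cst.
have c2 : {for m, continuous (fun m : R => m / Num.sqrt (1 + m ^+ 2))}.
  by apply: cvgM => //; exact: cvg_id.
exact: (cvg_pair c1 c2).
Qed.

(** A positive combination of the two directions has a slope strictly between [p] and [q]. *)
Lemma contact_gap K p q : sym_body K -> contact (reach K) p -> contact (reach K) q ->
  p < q -> (forall m, p < m < q -> ~ contact (reach K) m) ->
  is_gap K (unit_dir p) (unit_dir q).
Proof.
move=> bK Sp Sq pq nS.
have np0 : 0 < Num.sqrt (1 + p ^+ 2) by rewrite sqrtr_gt0 add1sqr_gt0.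
have nq0 : 0 < Num.sqrt (1 + q ^+ 2) by rewrite sqrtr_gt0 add1sqr_gt0.
split; rewrite ?sqnorm_unit_dir //.
- by split; apply/contact_reach.
- rewrite /wedge /unit_dir /=.
  rewrite (_ : _ - _ = (q - p) / (Num.sqrt (1 + p ^+ 2) * Num.sqrt (1 + q ^+ 2))).
    by rewrite divr_gt0 ?mulr_gt0 // subr_gt0.
  by field; rewrite !lt0r_neq0.
- move=> a b a0 b0 n1 Kab.
  pose a' := a / Num.sqrt (1 + p ^+ 2); pose b' := b / Num.sqrt (1 + q ^+ 2).
  have a'0 : 0 < a' by rewrite divr_gt0.
  have b'0 : 0 < b' by rewrite divr_gt0.
  have E : comb a (unit_dir p) b (unit_dir q) = (a' + b', a' * p + b' * q).
    by rewrite /comb /unit_dir /a' /b' /=; congr (_, _); field; rewrite !lt0r_neq0.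
  rewrite E in n1 Kab.
  have ab0 : 0 < a' + b' by rewrite addr_gt0.
  apply: (nS ((a' * p + b' * q) / (a' + b'))); last first.
    by apply: contact_ratio => //; rewrite lt0r_neq0.
  by rewrite ltr_pdivlMr // ltr_pdivrMr //; apply/andP; split; nra.
Qed.

End GapGeometry.

(** * Existence of a gap *)

Section GapExists.
Context {R : realType}.
Notation mu := (@lebesgue_measure R).
Notation mu2 := (mu \x mu)%E.
Implicit Types (K : set (R * R)) (u v : R * R).

Definition disk : set (R * R) := [set p | sqnorm p <= 1].

Lemma closed_disk : closed disk.
Proof.
rewrite (_ : disk = [set p | 1 * p.1 ^+ 2 + 0 * p.1 * p.2 + 1 * p.2 ^+ 2 <= 1]); first exact: closed_quad.
by apply/seteqP; split => p; rewrite /disk /sqnorm /= !mul0r !mul1r addr0.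
Qed.

Lemma sqnorm_slope (x m : R) : sqnorm (x, x * m) = x ^+ 2 * (1 + m ^+ 2).
Proof. by rewrite /sqnorm /=; ring. Qed.

Lemma mu2_disk : mu2 disk = (pi : R)%:E.
Proof.
have w0 (m : R) : 0 <= (1 + m ^+ 2)^-1 by rewrite invr_ge0 ltW // add1sqr_gt0.
have dw (x m : R) : disk (x, x * m) <-> x ^+ 2 <= (1 + m ^+ 2)^-1.
  rewrite /disk /= sqnorm_slope.
  by rewrite -[_ <= (1 + m ^+ 2)^-1](ler_pM2r (add1sqr_gt0 m)) mulVf // add1sqr_neq0.
have [_ E] := area_slope (closed_measurable2 closed_disk) w0 dw.
by rewrite E integral_oneDsqrV.
Qed.

Lemma area_disk : area disk = pi.
Proof. by rewrite /area mu2_disk. Qed.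

Lemma area_disk_cap K : sym_body K ->
  (mu2 (disk `&` K) = \int[mu]_m (Num.min (1 + m ^+ 2)^-1 (reach K m))%:E)%E.
Proof.
move=> bK; apply: area_reach_quad => //.
- exact: closed_disk.
- exact: add1sqr_gt0.
- exact: sqnorm_slope.
Qed.

Lemma area_rot K (c s : R) : c ^+ 2 + s ^+ 2 = 1 -> measurable K ->
  area (rot c s @^-1` K) = area K.
Proof. by move=> hcs mK; rewrite /area /rot area_lin // -hcs; ring. Qed.

Lemma disk_rot K (c s : R) : c ^+ 2 + s ^+ 2 = 1 ->
  disk `&` rot c s @^-1` K = rot c s @^-1` (disk `&` K).
Proof.
by move=> hcs; apply/seteqP; split => p; rewrite /disk /preimage /= sqnorm_rot.
Qed.

(** Were the contact set null, the minimum in [area_disk_cap] would be [reach K] almost everywhere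
    and the two areas would agree. *)
Lemma contact_mu_gt0 K : sym_body K -> area (disk `&` K) < area K ->
  (0 < mu (contact (reach K)))%E.
Proof.
move=> bK; rewrite lt0e measure_ge0 andbT => /lt_eqF/negP H; apply/eqP => S0; apply: H.
have [mr rE] := area_reach bK.
have mS : measurable (contact (reach K)) by apply: closed_measurable; exact: closed_contact.
rewrite /area area_disk_cap // rE; apply/eqP; congr fine.
apply: ae_eq_integral => //.
- apply/measurable_EFinP; apply: measurable_minr => //; exact: measurable_oneDsqrV.
- exact/measurable_EFinP.
exists (contact (reach K)); split => // m /= nE; apply: contrapT => nS; apply: nE => _.
by congr EFin; apply/min_idPr; move/negP : nS; rewrite /contact /= -ltNge => /ltW.
Qed.

Lemma unit_outside K : sym_body K -> area (disk `&` K) < pi ->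
  exists2 d, sqnorm d = 1 & ~ K d.
Proof.
move=> bK lt; apply: contrapT => H.
have {}H d : sqnorm d = 1 -> K d.
  by move=> d1; apply: contrapT => nK; apply: H; exists d.
suff E : disk `&` K = disk by move: lt; rewrite E area_disk ltxx.
apply/setIidPl => p p1.
have [p0|p0] := eqVneq (sqnorm p) 0.
  move: p0; rewrite /sqnorm => p0.
  have := sqr_ge0 p.1; have := sqr_ge0 p.2 => h2 h1.
  have /eqP : p.1 ^+ 2 = 0 by lra.
  have /eqP : p.2 ^+ 2 = 0 by lra.
  rewrite !sqrf_eq0 => /eqP e2 /eqP e1.
  by rewrite [p]surjective_pairing e1 e2; exact: body0.
pose n := Num.sqrt (sqnorm p).
have sp0 : 0 <= sqnorm p by rewrite addr_ge0 ?sqr_ge0.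
have n0 : n != 0 by rewrite lt0r_neq0 // sqrtr_gt0 lt_neqAle eq_sym p0.
have Kn : K (p.1 / n, p.2 / n).
  by apply: H; rewrite /sqnorm /= !expr_div_n -mulrDl sqr_sqrtr // divff.
have n1 : `|n| <= 1.
  by rewrite ger0_norm ?sqrtr_ge0 // -sqrtr1 ler_wsqrtr.
have := body_scale bK Kn n1; rewrite ![n * _]mulrC !divfK //.
by rewrite -surjective_pairing.
Qed.

(** Steep directions are close to [(0, 1)] or its antipode, and the complement of [K] is open. *)
Lemma contact_bounded K : sym_body K -> ~ K (0, 1) ->
  exists M : R, forall m, contact (reach K) m -> `|m| <= M.
Proof.
move=> bK nK.
have oC : open (~` K) by apply: closed_openC; exact: body_closed.
have /nbhs_ballP [e /= e0 eK] : nbhs ((0, 1) : R * R) (~` K) by exact: open_nbhs_nbhs.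
exists e^-1 => m Sm; rewrite leNgt; apply/negP => me.
pose n := Num.sqrt (1 + m ^+ 2).
have n2 : n ^+ 2 = 1 + m ^+ 2 by rewrite sqr_sqrtr // ltW // add1sqr_gt0.
have n0 : 0 < n by rewrite sqrtr_gt0 add1sqr_gt0.
have m2 : `|m| ^+ 2 = m ^+ 2 by rewrite real_normK ?num_real.
have nm : `|m| < n by rewrite -ltr_sqr ?nnegrE ?(ltW n0) // m2 n2 ltrDr.
have ie : 0 < e^-1 by rewrite invr_gt0.
have ne : n^-1 < e by rewrite -[e]invrK ltf_pV2 ?posrE //; exact: lt_trans nm.
have nn := lt0r_neq0 n0.
have key : K (1 / n, `|m| / n) \/ K (- (1 / n), `|m| / n).
  have := contact_reach m bK; rewrite /unit_dir -/n => -[/(_ Sm) Km _].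
  have [->|->] : `|m| = m \/ `|m| = - m by case: (ger0P m); [left|right].
    by left.
  by right; rewrite mulNr; exact: bodyN.
have yl : `|1 - `|m| / n| < e.
  have -> : 1 - `|m| / n = (n - `|m|) / n by field.
  rewrite ger0_norm; last by rewrite divr_ge0 ?subr_ge0 // ltW.
  apply: le_lt_trans ne; rewrite ler_piMl ?invr_ge0 ?(ltW n0) //.
  have : n ^+ 2 - `|m| ^+ 2 = 1 by rewrite n2 m2; ring.
  have := normr_ge0 m; nra.
have xl : `|1 / n| < e by rewrite div1r gtr0_norm ?invr_gt0.
have far x y : `|x| < e -> `|1 - y| < e -> ~ K (x, y).
  move=> hx hy; apply: eK; split => /=; rewrite -ball_normE /ball_ /= ?sub0r ?normrN //.
by case: key; apply: far; rewrite ?normrN.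
Qed.

(** The gap runs from the largest contact slope over the vertical to the antipode of the smallest;
    the two slopes differ because a single point is null. *)
Lemma vertical_gap K : sym_body K -> ~ K (0, 1) -> (0 < mu (contact (reach K)))%E ->
  exists u v, is_gap K u v.
Proof.
move=> bK nK; rewrite lt0e => /andP[muS _].
set S := contact (reach K) in muS.
have clS : closed S by exact: closed_contact.
have [M SM] := contact_bounded bK nK.
have S0 : S !=set0.
  by apply/set0P; apply: contra muS => /eqP ->; rewrite measure0.
have hs : has_sup S by split => //; exists M => m /SM; exact/le_trans/ler_norm.
have hi : has_inf S.
  by split => //; exists (- M) => m /SM; rewrite ler_norml => /andP[].
pose b := sup S; pose a := inf S.
have Sb : S b by apply: clS; apply: closure_sup => //; case: hs.
have Sa : S a.
  apply: clS => B /nbhs_ballP[e /= e0 eB].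
  have ae : a < a + e by lra.
  have [y Sy ya] := inf_lt S0 ae; exists y; split => //; apply: eB.
  rewrite -ball_normE /ball_ /= distrC ger0_norm; first by lra.
  by rewrite subr_ge0; apply: ge_inf => //; case: hi.
have leb m : S m -> m <= b by move=> Sm; apply: ub_le_sup => //; case: hs.
have gea m : S m -> a <= m by move=> Sm; apply: ge_inf => //; case: hi.
have ab : a < b.
  rewrite lt_neqAle gea // andbT; apply: contra muS => /eqP abE.
  rewrite -measure_le0 -(lebesgue_measure_set1 a).
  apply: le_measure; rewrite ?inE; [exact: closed_measurable|exact: measurable_set1|].
  by move=> m Sm /=; apply/eqP; rewrite eq_le gea // abE leb.
exists (unit_dir b), (- (unit_dir a).1, - (unit_dir a).2).
have na0 : 0 < Num.sqrt (1 + a ^+ 2) by rewrite sqrtr_gt0 add1sqr_gt0.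
have nb0 : 0 < Num.sqrt (1 + b ^+ 2) by rewrite sqrtr_gt0 add1sqr_gt0.
split.
- exact: sqnorm_unit_dir.
- by rewrite -[RHS](sqnorm_unit_dir a) /sqnorm /= !sqrrN.
- split; first exact/contact_reach.
  by apply: bodyN => //; apply/contact_reach.
- rewrite /wedge /unit_dir /=.
  rewrite (_ : _ - _ = (b - a) / (Num.sqrt (1 + a ^+ 2) * Num.sqrt (1 + b ^+ 2))).
    by rewrite divr_gt0 ?mulr_gt0 // subr_gt0.
  by field; rewrite !lt0r_neq0.
move=> c d c0 d0.
pose c' := c / Num.sqrt (1 + b ^+ 2); pose d' := d / Num.sqrt (1 + a ^+ 2).
have c'0 : 0 < c' by rewrite divr_gt0.
have d'0 : 0 < d' by rewrite divr_gt0.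
have -> : comb c (unit_dir b) d (- (unit_dir a).1, - (unit_dir a).2) = (c' - d', c' * b - d' * a).
  by rewrite /comb /unit_dir /c' /d' /=; congr (_, _); field; rewrite !lt0r_neq0.
move=> n1 Kcd.
(* Right of the vertical the slope exceeds [b], left of it the slope is below [a], and on it the
   point is [(0, 1)]. *)
have [xp|xn|x0] := ltgtP 0 (c' - d').
- have := leb _ (contact_ratio bK Kcd n1 (lt0r_neq0 xp)).
  by rewrite ler_pdivrMr //; nra.
- have xn' : c' - d' != 0 by rewrite lt_eqF.
  have := gea _ (contact_ratio bK Kcd n1 xn').
  by rewrite ler_ndivlMr //; nra.
- apply: nK; have cd : d' = c' by lra.
  move: n1 Kcd; rewrite cd subrr /sqnorm /= expr0n add0r => n1.
  have -> // : c' * b - c' * a = 1.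
  have y0 : 0 <= c' * b - c' * a by rewrite -mulrBr mulr_ge0 ?subr_ge0 // ltW.
  by apply/eqP; rewrite -(@eqrXn2 _ 2) // expr1n n1.
Qed.

(** The bound by [pi] yields a direction missed by [K], turned to the vertical; the bound by the
    area of [K] yields a contact set of positive measure. *)
Lemma exists_gap K : sym_body K -> area (disk `&` K) < Num.min pi (area K) ->
  exists u v, is_gap K u v.
Proof.
move=> bK; rewrite lt_min => /andP[lt1 lt2].
have [d d1 nKd] := unit_outside bK lt1.
pose c := d.2; pose s := - d.1.
have hcs : c ^+ 2 + s ^+ 2 = 1 by rewrite -d1 /sqnorm /c /s sqrrN addrC.
have bK' := sym_body_rot hcs bK.
have mK : measurable K by apply: closed_measurable2; exact: body_closed.
have mdK : measurable (disk `&` K).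
  by apply: measurableI => //; apply: closed_measurable2; exact: closed_disk.
have nK' : ~ (rot c s @^-1` K) (0, 1).
  rewrite /preimage /rot /lin /= !mulr0 !mulr1 !add0r /s opprK /c.
  by rewrite -surjective_pairing.
have := contact_mu_gt0 bK'; rewrite disk_rot // !area_rot // => /(_ lt2) muS.
have [u [v g]] := vertical_gap bK' nK' muS.
by exists (rot c s u), (rot c s v); apply/is_gap_rot.
Qed.

End GapExists.

(** * Local minima of the intersection area *)

Section LocalMin.
Context {R : realType}.
Notation mu := (@lebesgue_measure R).
Notation mu2 := (mu \x mu)%E.
Implicit Types (K : set (R * R)) (u v : R * R).

(** It carries [ellipse r] onto [ellipse (t + r)], so the family looks the same from each of its
    members. *)
Definition stretch (t : R) : R * R -> R * R := lin (expR (- (t / 2))) 0 0 (expR (t / 2)).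

Lemma stretch_det (t : R) : expR (- (t / 2)) * expR (t / 2) - 0 * 0 = 1.
Proof. by rewrite -expRD addNr expR0 mulr0 subr0. Qed.

Lemma closed_ellipse (t : R) : closed (ellipse t).
Proof.
rewrite (_ : ellipse t = [set p | expR t * p.1 ^+ 2 + 0 * p.1 * p.2 + expR (- t) * p.2 ^+ 2 <= 1]).
  exact: closed_quad.
by apply/seteqP; split => p; rewrite /ellipse /= !mul0r addr0.
Qed.

Lemma measurable_ellipse_cap K (t : R) : sym_body K -> measurable (ellipse t `&` K).
Proof.
move=> bK; apply: measurableI; apply: closed_measurable2; first exact: closed_ellipse.
exact: body_closed.
Qed.

Lemma stretch_ellipse K (t r : R) :
  stretch t @^-1` (ellipse (t + r) `&` K) = ellipse r `&` stretch t @^-1` K.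
Proof.
rewrite preimage_setI; congr (_ `&` _).
have e1 (x : R) : expR (t + r) * (expR (- (t / 2)) * x) ^+ 2 = expR r * x ^+ 2.
  by rewrite exprMn mulrA expr2 -!expRD; congr (expR _ * _); field.
have e2 (x : R) : expR (- (t + r)) * (expR (t / 2) * x) ^+ 2 = expR (- r) * x ^+ 2.
  by rewrite exprMn mulrA expr2 -!expRD; congr (expR _ * _); field.
by apply/seteqP; split => p; rewrite /ellipse /preimage /stretch /lin /= !mul0r addr0 add0r e1 e2.
Qed.

Lemma ellipse0 : ellipse 0 = disk :> set (R * R).
Proof.
by apply/seteqP; split => p; rewrite /ellipse /disk /sqnorm /= oppr0 expR0 !mul1r.
Qed.

Lemma intersection_area_stretch K (t : R) : sym_body K ->
  intersection_area K t = area (disk `&` stretch t @^-1` K).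
Proof.
move=> bK; rewrite -ellipse0 -stretch_ellipse addr0 /intersection_area /area /stretch.
by rewrite area_lin //; [exact: stretch_det|exact: measurable_ellipse_cap].
Qed.

Section Chart.
Context (c s : R) (hcs : c ^+ 2 + s ^+ 2 = 1).
Let al := c ^+ 2 - s ^+ 2.
Let be := - 2 * c * s.

Lemma chart_axes : al ^+ 2 + be ^+ 2 = 1.
Proof.
rewrite -[RHS](expr1n _ 2) -hcs /al /be; ring.
Qed.

(* [exp r = (1 + tau) / (1 - tau)] makes the radial function of the ellipse rational. *)
Lemma intersection_area_chart K (t tau : R) : sym_body K -> `|tau| <= 1 / 2 ->
  intersection_area K (t + ln ((1 + tau) / (1 - tau))) =
  \int[mu]_m capped al be (reach (rot c s @^-1` (stretch t @^-1` K))) tau m.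
Proof.
move=> bK ht; move: (ht); rewrite ler_norml => /andP[t1 t2].
have tp : 0 < 1 + tau by lra.
have tm : 0 < 1 - tau by lra.
have t2' : 0 < 1 - tau ^+ 2 by nra.
have tmn := lt0r_neq0 tm; have tpn := lt0r_neq0 tp; have t2n := lt0r_neq0 t2'.
pose r := ln ((1 + tau) / (1 - tau)).
have er : expR r = (1 + tau) / (1 - tau) by rewrite lnK // posrE divr_gt0.
have enr : expR (- r) = (1 - tau) / (1 + tau) by rewrite expRN er invf_div.
have bK1 : sym_body (stretch t @^-1` K) by apply: sym_body_lin => //; exact: stretch_det.
have bK2 := sym_body_rot hcs bK1.
pose Q (p : R * R) := expR r * (c * p.1 - s * p.2) ^+ 2 + expR (- r) * (s * p.1 + c * p.2) ^+ 2.
have QE : rot c s @^-1` (ellipse r `&` stretch t @^-1` K) =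
    [set p | Q p <= 1] `&` rot c s @^-1` (stretch t @^-1` K).
  rewrite preimage_setI; congr (_ `&` _).
  by apply/seteqP; split => p; rewrite /ellipse /preimage /rot /lin /Q /= mulNr.
have -> : intersection_area K (t + r) = area ([set p | Q p <= 1] `&` rot c s @^-1` (stretch t @^-1` K)).
  rewrite -QE area_rot //; last exact: measurable_ellipse_cap.
  rewrite -stretch_ellipse /intersection_area /area /stretch area_lin //.
    exact: stretch_det.
  exact: measurable_ellipse_cap.
have D (m : R) := rho_den_ge chart_axes m ht.
pose q m := (1 + m ^+ 2) * (1 + tau ^+ 2 + 2 * tau * xi al be m) / (1 - tau ^+ 2).
rewrite /area (@area_reach_quad _ _ Q q) //.
- rewrite /Rintegral; congr fine; apply: eq_integral => m _; congr (EFin (Num.min _ _)).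
  by rewrite /q invf_div.
- rewrite (_ : [set p | _] = [set p | (expR r * c ^+ 2 + expR (- r) * s ^+ 2) * p.1 ^+ 2 +
     (2 * c * s * (expR (- r) - expR r)) * p.1 * p.2 +
     (expR r * s ^+ 2 + expR (- r) * c ^+ 2) * p.2 ^+ 2 <= 1]); first exact: closed_quad.
  apply: eq_set => p; congr (is_true (_ <= _)); rewrite /Q; ring.
- by move=> m; rewrite /q divr_gt0 // mulr_gt0 ?add1sqr_gt0 //; have := D m; lra.
- move=> x m; rewrite /Q /q er enr /xi /=.
  have mn := add1sqr_neq0 m.
  transitivity (x ^+ 2 * ((1 + tau) ^+ 2 * (c - s * m) ^+ 2 + (1 - tau) ^+ 2 * (s + c * m) ^+ 2) / (1 - tau ^+ 2)).
    have -> : 1 - tau ^+ 2 = (1 + tau) * (1 - tau) by ring.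
    by field; rewrite tmn tpn.
  transitivity (x ^+ 2 * ((c ^+ 2 + s ^+ 2) * (1 + tau ^+ 2) * (1 + m ^+ 2) + 2 * tau * (al * (1 - m ^+ 2) + 2 * be * m)) / (1 - tau ^+ 2)).
    congr (_ * _ / _); rewrite /al /be; ring.
  by rewrite hcs; field; rewrite t2n mn.
Qed.

End Chart.

(** [tau] is the hyperbolic tangent of half the parameter, and [(E - 1) / (E + 1)] is that of
    [d / 2]. *)
Lemma small_time (d : R) : 0 < d -> exists2 e : R, 0 < e & forall tau, `|tau| < e ->
  `|tau| <= 1 / 2 /\ `|ln ((1 + tau) / (1 - tau))| < d.
Proof.
move=> d0; pose E := expR d.
have E1 : 1 < E by rewrite -expR0 ltr_expR.
exists (Num.min (1 / 2) ((E - 1) / (E + 1))).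
  by rewrite lt_min divr_gt0 //= ?divr_gt0 //; lra.
move=> tau; rewrite lt_min => /andP[h1 h2]; split; first exact: ltW.
move: h1 h2; rewrite !ltr_norml => /andP[a1 a2] /andP[b1 b2].
have E10 : 0 < E + 1 by lra.
have tp : 0 < 1 + tau by lra.
have tm : 0 < 1 - tau by lra.
move: b1 b2; rewrite -mulNr ltr_pdivlMr // ltr_pdivrMr // => b1 b2.
rewrite -[- d < _]ltr_expR -[_ < d]ltr_expR lnK ?posrE ?divr_gt0 // expRN -/E; apply/andP; split.
  by rewrite ltr_pdivlMr // -div1r mulrAC ltr_pdivrMr; lra.
by rewrite ltr_pdivrMr //; lra.
Qed.

(** The strict inequality puts [(x, y)] in the open cone spanned by the ends of the gap. *)
Lemma gap_excludes K (X Y x y : R) : 0 < X -> 0 < Y -> is_gap K (X, Y) (- X, Y) ->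
  x ^+ 2 + y ^+ 2 = 1 -> `|x| * Y < y * X -> ~ K (x, y).
Proof.
move=> X0 Y0 [_ _ _ _ between] n1 xy.
have Xn := lt0r_neq0 X0; have Yn := lt0r_neq0 Y0.
have /andP[h1 h2] : - (y * X) < x * Y < y * X.
  by rewrite -ltr_norml normrM (gtr0_norm Y0).
pose a := (y * X + x * Y) / (2 * X * Y); pose b := (y * X - x * Y) / (2 * X * Y).
have D0 : 0 < 2 * X * Y by rewrite !mulr_gt0.
have a0 : 0 < a by rewrite divr_gt0 //; lra.
have b0 : 0 < b by rewrite divr_gt0 //; lra.
have E : comb a (X, Y) b (- X, Y) = (x, y).
  by rewrite /comb /a /b /=; congr (_, _); field; rewrite Xn Yn.
by have := between a b a0 b0; rewrite E; exact.
Qed.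

Lemma inner_unit_dir (p q : R) : inner (unit_dir p) (unit_dir q) =
  (1 + p * q) / (Num.sqrt (1 + p ^+ 2) * Num.sqrt (1 + q ^+ 2)).
Proof.
have np0 : 0 < Num.sqrt (1 + p ^+ 2) by rewrite sqrtr_gt0 add1sqr_gt0.
have nq0 : 0 < Num.sqrt (1 + q ^+ 2) by rewrite sqrtr_gt0 add1sqr_gt0.
by rewrite /inner /unit_dir /=; field; rewrite !lt0r_neq0.
Qed.

Lemma reach_chord K (p q m : R) : sym_body K -> contact (reach K) p -> contact (reach K) q ->
  p < m < q ->
  ((q - p) / (Num.sqrt (1 + p ^+ 2) * (q - m) + Num.sqrt (1 + q ^+ 2) * (m - p))) ^+ 2 <= reach K m.
Proof.
move=> bK /(contact_reach p bK) Kp /(contact_reach q bK) Kq /andP[pm mq].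
apply/reachP => //; move: Kp Kq; rewrite /unit_dir.
have : 0 < Num.sqrt (1 + p ^+ 2) by rewrite sqrtr_gt0 add1sqr_gt0.
have : 0 < Num.sqrt (1 + q ^+ 2) by rewrite sqrtr_gt0 add1sqr_gt0.
set a := Num.sqrt (1 + p ^+ 2); set b := Num.sqrt (1 + q ^+ 2) => b0 a0 Kp Kq.
have d1 : 0 < q - m by lra.
have d2 : 0 < m - p by lra.
have D0 : 0 < a * (q - m) + b * (m - p) by rewrite addr_gt0 // mulr_gt0.
have al0 : 0 <= a * (q - m) / (a * (q - m) + b * (m - p)).
  by rewrite divr_ge0 // ltW // mulr_gt0.
have be0 : 0 <= b * (m - p) / (a * (q - m) + b * (m - p)).
  by rewrite divr_ge0 // ltW // mulr_gt0.
have an := lt0r_neq0 a0; have bn := lt0r_neq0 b0; have Dn := lt0r_neq0 D0.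
have s1 : a * (q - m) / (a * (q - m) + b * (m - p)) + b * (m - p) / (a * (q - m) + b * (m - p)) <= 1.
  by rewrite -mulrDl divff.
have := body_comb bK Kp Kq al0 be0 s1; rewrite /=.
rewrite (_ : _ * (1 / a) + _ = (q - p) / (a * (q - m) + b * (m - p))); last by field; rewrite an bn Dn.
rewrite (_ : _ * (p / a) + _ = (q - p) / (a * (q - m) + b * (m - p)) * m) //.
by field; rewrite an bn Dn.
Qed.

Lemma no_local_min K (t : R) : sym_body K ->
  intersection_area K t < Num.min pi (area K) ->
  ~ (exists2 d : R, 0 < d & forall t', `|t' - t| < d ->
       intersection_area K t <= intersection_area K t').
Proof.
move=> bK lt [d d0 H].
pose K1 := stretch t @^-1` K.
have bK1 : sym_body K1 by apply: sym_body_lin => //; exact: stretch_det.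
have mK : measurable K by apply: closed_measurable2; exact: body_closed.
have aK1 : area K1 = area K.
  by rewrite /area /K1 /stretch area_lin //; exact: stretch_det.
have lt1 : area (disk `&` K1) < Num.min pi (area K1) by rewrite aK1 -intersection_area_stretch.
(* A gap of at least a right angle is preferred; if there is none, all gaps are acute and any one
   will do. *)
have [u [v [g large]]] : exists u v, is_gap K1 u v /\
    (inner u v <= 0 \/ forall u' v', is_gap K1 u' v' -> 0 < inner u' v').
  have [[u [v [g uv]]]|nl] := pselect (exists u v, is_gap K1 u v /\ inner u v <= 0).
    by exists u, v; split => //; left.
  have [u [v g]] := exists_gap bK1 lt1.
  exists u, v; split => //; right => u' v' g'; rewrite ltNge; apply/negP => uv'.
  by apply: nl; exists u', v'.
have [c [s [X [Y [hcs X0 Y0 XY gXY]]]]] := gap_chart g.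
pose K2 := rot c s @^-1` K1.
have bK2 : sym_body K2 by exact: sym_body_rot.
have [n1 _ [KX KNX] _ between] := gXY.
rewrite /sqnorm /= in n1.
pose P := Y / X.
have P0 : 0 < P by rewrite divr_gt0.
have Xn := lt0r_neq0 X0; have Yn := lt0r_neq0 Y0.
have XE : X ^+ 2 = (1 + P ^+ 2)^-1.
  rewrite /P expr_div_n (_ : 1 + Y ^+ 2 / X ^+ 2 = (X ^+ 2 + Y ^+ 2) / X ^+ 2); last by field.
  by rewrite n1 div1r invrK.
have YE : Y ^+ 2 = P ^+ 2 / (1 + P ^+ 2) by rewrite -XE /P expr_div_n divfK // expf_neq0.
have [mw w_area] := area_reach bK2.
apply: (@no_critical _ _ _ (chart_axes hcs) (reach K2) mw (reach_ge0 K2) P P0).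
- exact: closed_contact.
- move=> m Pm; rewrite ltNge; apply/negP => Sm.
  have /(contact_reach m bK2) Km : contact (reach K2) m by [].
  have nm0 : 0 < Num.sqrt (1 + m ^+ 2) by rewrite sqrtr_gt0 add1sqr_gt0.
  have nm := lt0r_neq0 nm0.
  have nu (x : R) : (x / Num.sqrt (1 + m ^+ 2)) ^+ 2 = (- x / Num.sqrt (1 + m ^+ 2)) ^+ 2.
    by rewrite mulNr sqrrN.
  have := sqnorm_unit_dir m; rewrite /sqnorm /= => nrm.
  have [mm|mm] : `|m| = m \/ `|m| = - m by case: (ger0P m); [left|right].
    apply: (gap_excludes X0 Y0 gXY nrm) Km.
    rewrite ger0_norm ?divr_ge0 ?ltW // mulrAC [ltRHS]mulrAC ltr_pM2r ?invr_gt0 // mul1r.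
    by rewrite -ltr_pdivrMr // -mm.
  have := bodyN bK2 Km.
  apply: (gap_excludes X0 Y0 gXY); first by rewrite !sqrrN.
  rewrite normrN ger0_norm ?divr_ge0 ?ltW // -mulNr mulrAC [ltRHS]mulrAC ltr_pM2r ?invr_gt0 // mul1r.
  by rewrite -ltr_pdivrMr // -mm.
- rewrite /contact /= -XE; apply/reachP => //.
  by rewrite /P mulrC divfK.
- rewrite /contact /= sqrrN -XE -[X ^+ 2]sqrrN; apply/reachP => //.
  by rewrite /P mulrNN mulrC divfK.
- move=> m Pm.
  have m0 : 0 < `|m| by exact: lt_trans Pm.
  have mn : m != 0 by rewrite -normr_gt0.
  (* The line of slope [m] meets the horizontal chord at [(Y / m, Y)]. *)
  have : (Y / m) ^+ 2 = P ^+ 2 / ((1 + P ^+ 2) * m ^+ 2) by rewrite expr_div_n YE -mulrA -invfM.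
  move=> <-; apply/reachP => //; rewrite divfK //.
  have /andP[l1 l2] : - X <= Y / m <= X.
    rewrite -ler_norml normrM normfV (gtr0_norm Y0) ler_pdivrMr //.
    by move: Pm; rewrite /P ltr_pdivrMr // mulrC => /ltW.
  have a0 : 0 <= (X + Y / m) / (2 * X) by rewrite divr_ge0 //; lra.
  have b0 : 0 <= (X - Y / m) / (2 * X) by rewrite divr_ge0 //; lra.
  have ab : (X + Y / m) / (2 * X) + (X - Y / m) / (2 * X) = 1 by field; rewrite mn Xn.
  have := body_comb bK2 KX KNX a0 b0; rewrite ab => /(_ (lexx 1)) /=.
  rewrite -mulrDl ab mul1r (_ : _ + _ = Y / m) //.
  by field; rewrite mn Xn.
- move=> p q Sp Sq pq m pmq.
  exact: reach_chord.
- have [e e0 He] := small_time d0.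
  exists e => // tau te.
  have [t2 lnd] := He _ te.
  rewrite -(intersection_area_chart hcs t bK norm0_le_half) -(intersection_area_chart hcs t bK t2).
  rewrite addr0 subr0 divr1 ln1 addr0; apply: H.
  by rewrite addrAC subrr add0r.
- apply: contact_mu_gt0 => //.
  have mK1 : measurable K1 by apply: closed_measurable2; exact: body_closed.
  have mdK1 : measurable (disk `&` K1).
    by apply: measurableI => //; apply: closed_measurable2; exact: closed_disk.
  by rewrite /K2 disk_rot // !area_rot //; move: lt1; rewrite lt_min => /andP[].
- case: large => [uv|pos].
    left; rewrite /P ler_pdivrMr // mul1r -ler_sqr ?nnegrE ?(ltW X0) ?(ltW Y0) //.
    by rewrite -subr_le0 XY.
  right=> p q Sp Sq pq nS.
  have /(is_gap_rot hcs)/pos := contact_gap bK2 Sp Sq pq nS.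
  rewrite inner_rot // inner_unit_dir pmulr_lgt0 => [/ltW //|].
  by rewrite invr_gt0 mulr_gt0 // sqrtr_gt0 add1sqr_gt0.
Qed.

End LocalMin.

(** * Continuity of the intersection area *)

Section Continuity.
Context {R : realType}.
Notation mu := (@lebesgue_measure R).
Notation mu2 := (mu \x mu)%E.
Implicit Types K : set (R * R).

Let q (t m : R) : R := expR t + expR (- t) * m ^+ 2.

Let q_gt0 t m : 0 < q t m.
Proof. by rewrite /q ltr_pwDl ?expR_gt0 // mulr_ge0 ?expR_ge0 ?sqr_ge0. Qed.

Let le_q s t m : q s m <= expR `|t - s| * q t m.
Proof.
rewrite /q mulrDr mulrA -!expRD lerD ?ler_wpM2r ?sqr_ge0 ?ler_expR //.
  by have := ler_norm (- (t - s)); rewrite normrN; lra.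
by have := ler_norm (t - s); lra.
Qed.

Let mu2_ellipse_cap K t : sym_body K ->
  mu2 (ellipse t `&` K) = (\int[mu]_m (Num.min (q t m)^-1 (reach K m))%:E)%E.
Proof.
move=> bK; apply: area_reach_quad => //; first exact: closed_ellipse.
by move=> x m; rewrite /q /=; ring.
Qed.

Let measurable_min_q K t : sym_body K ->
  measurable_fun setT (fun m => Num.min (q t m)^-1 (reach K m)).
Proof.
move=> bK; apply: measurable_minr; last exact: (area_reach bK).1.
apply: continuous_measurable_fun => m; apply: cvgV; first by rewrite lt0r_neq0.
apply: cvgD; first exact: cvg_cst.
by apply: cvgM; [exact: cvg_cst|exact: exprn_continuous].
Qed.

(** On every ray the two quadratic forms differ by a factor at most [expR |t - s|]; the cap
    [reach K] respects this because the factor is at least 1. Continuity follows by squeezing. *)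
Lemma mu2_ellipse_cap_le K s t : sym_body K ->
  (mu2 (ellipse t `&` K) <= (expR `|t - s|)%:E * mu2 (ellipse s `&` K))%E.
Proof.
move=> bK; rewrite !mu2_ellipse_cap //.
have ge0 r m : 0 <= Num.min (q r m)^-1 (reach K m).
  by rewrite le_min reach_ge0 invr_ge0 ltW.
rewrite -ge0_integralZl_EFin ?expR_ge0 //; last 2 first.
- by move=> m _; rewrite lee_fin.
- by apply/measurable_EFinP; exact: measurable_min_q.
apply: ge0_le_integral => //.
- by move=> m _; rewrite lee_fin.
- by apply/measurable_EFinP; exact: measurable_min_q.
- apply/measurable_EFinP; apply: measurable_funM => //; exact: measurable_min_q.
move=> m _; rewrite lee_fin minr_pMr ?expR_ge0 // le_min; apply/andP; split.
  rewrite ge_min; apply/orP; left.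
  rewrite -(ler_pM2r (q_gt0 t m)) mulVf ?lt0r_neq0 // mulrAC.
  by rewrite ler_pdivlMr // mul1r; exact: le_q.
rewrite ge_min; apply/orP; right.
by rewrite ler_peMl ?reach_ge0 // -expR0 ler_expR normr_ge0.
Qed.

(** Comparison with parameter 0 reduces this to the disk; finiteness makes [fine] faithful in
    [intersection_area]. *)
Lemma mu2_ellipse_cap_fin K t : sym_body K -> mu2 (ellipse t `&` K) \is a fin_num.
Proof.
move=> bK; rewrite ge0_fin_numE //.
apply: (le_lt_trans (mu2_ellipse_cap_le 0 t bK)).
rewrite -ge0_fin_numE ?mule_ge0 ?lee_fin ?expR_ge0 // fin_numM // ge0_fin_numE //.
apply: (@le_lt_trans _ _ (mu2 (ellipse 0))).
  have mE : measurable (ellipse 0 : set (R * R)) by apply: closed_measurable2; exact: closed_ellipse.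
  by apply: le_measure; rewrite ?inE //; exact: measurable_ellipse_cap.
rewrite ellipse0 mu2_disk; exact: ltry.
Qed.

Lemma intersection_area_le K s t : sym_body K ->
  intersection_area K t <= expR `|t - s| * intersection_area K s.
Proof.
move=> bK; have E r : (intersection_area K r)%:E = mu2 (ellipse r `&` K).
  by apply: fineK; exact: mu2_ellipse_cap_fin.
by have := mu2_ellipse_cap_le s t bK; rewrite -(E s) -(E t) -EFinM lee_fin.
Qed.

Lemma continuous_intersection_area K : sym_body K -> continuous (intersection_area K).
Proof.
move=> bK t.
have c1 : (fun s : R => expR `|s - t|) @ t --> (1 : R).
  rewrite -expR0 -[X in expR X](normr0 R) -(subrr t).
  apply: (@continuous_comp _ _ _ (fun s : R => `|s - t|) expR); last exact: continuous_expR.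
  by apply: cvg_norm; apply: cvgB; [exact: cvg_id|exact: cvg_cst].
apply: (@squeeze_cvgr _ _ _ _ (fun s => (expR `|s - t|)^-1 * intersection_area K t)
  (fun s => expR `|s - t| * intersection_area K t)).
- near=> s; rewrite (intersection_area_le _ _ bK) andbT.
  rewrite -ler_pdivlMl ?invr_gt0 ?expR_gt0 // invrK distrC.
  exact: intersection_area_le.
- rewrite -[X in _ --> X]mul1r; apply: cvgM; last exact: cvg_cst.
  by rewrite -[X in _ --> X]invr1; apply: cvgV.
- by rewrite -[X in _ --> X]mul1r; apply: cvgM => //; exact: cvg_cst.
Unshelve. all: by end_near. Qed.

End Continuity.

(** If the minimum over [[a, c]] is attained at an end, then [b], whose value is no larger, is a
    minimum as well. *)
Lemma interior_local_min (R : realType) (f : R -> R) (a b c : R) :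
  continuous f -> a < b -> b < c -> f b <= f a -> f b <= f c ->
  exists t, a < t < c /\ exists2 d, 0 < d & forall t', `|t' - t| < d -> f t <= f t'.
Proof.
move=> cf ab bc fa fc; have ac := lt_trans ab bc.
have [t tac tmin] := EVT_min (ltW ac) (continuous_subspaceT cf).
have inner r : a < r < c -> f r <= f t ->
    exists t, a < t < c /\ exists2 d, 0 < d & forall t', `|t' - t| < d -> f t <= f t'.
  move=> /andP[ar rc] frt; exists r; rewrite ar rc; split => //.
  exists (Num.min (r - a) (c - r)); first by rewrite lt_min !subr_gt0 ar rc.
  move=> t'; rewrite lt_min !ltr_norml => /andP[/andP[h1 _] /andP[_ h2]].
  by apply: (le_trans frt); apply: tmin; rewrite in_itv /=; lra.
move: tac; rewrite in_itv /= !le_eqVlt => /andP[/orP[/eqP ta|at_]].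
  by move=> _; apply: (inner b); rewrite ?ab ?bc // -ta.
by move=> /orP[/eqP tc|tc]; [apply: (inner b); rewrite ?ab ?bc // tc|apply: (inner t); rewrite ?at_ ?tc].
Qed.

Unset Implicit Arguments.

Theorem theorem3p7 (R : realType) (K : set (R * R)) (J : set R)
  (K_body : convex_body K) (K_sym : centrally_symmetric K)
  (J_itv : is_interval J)
  (J_lt : forall t : R, J t -> intersection_area K t < Num.min pi (area K)) :
  strictly_quasiconcave_on J (intersection_area K).
Proof.
have bK := sym_body_convex_body K_body K_sym.
move=> t0 t1 t2 J0 J1 J2 t01 t12; rewrite ltNge; apply/negP; rewrite le_min => /andP[h0 h2].
have [t [/andP[a b] locmin]] :=
  interior_local_min (continuous_intersection_area bK) t01 t12 h0 h2.
apply: (no_local_min bK _ locmin); apply: J_lt.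
by apply: (J_itv _ _ J0 J2); rewrite !ltW.
Qed.
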